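(* The evident forgetful functor $U:\infty\text{-}\mathbb{C}\mathbb{G}\mathrm{rp}\to\mathbb{C}\mathrm{Sets}$ from the category of cubical strict $\infty$-groupoids to the category of cubical sets, sending a cubical strict $\infty$-groupoid to its underlying cubical set, is a right adjoint (i.e. it has a left adjoint) and is monadic.
   Context: **Cubical sets.** A cubical set is a family of sets $(C_n)_{n\ge 0}$ with maps (sources and targets) $s^n_{n-1,j},t^n_{n-1,j}:C_n\to C_{n-1}$ for $n\ge1$, $1\le j\le n$, such that for $1\le i<j\le n$: $s^{n-1}_{n-2,i}s^n_{n-1,j}=s^{n-1}_{n-2,j-1}s^n_{n-1,i}$; $s^{n-1}_{n-2,i}t^n_{n-1,j}=t^{n-1}_{n-2,j-1}s^n_{n-1,i}$; $t^{n-1}_{n-2,i}s^n_{n-1,j}=s^{n-1}_{n-2,j-1}t^n_{n-1,i}$; $t^{n-1}_{n-2,i}t^n_{n-1,j}=t^{n-1}_{n-2,j-1}t^n_{n-1,i}$. Morphisms are families of maps commuting with all sources and targets. The category is $\mathbb{C}\mathrm{Sets}$. **Reflexive cubical sets.** A reflexive cubical set is a cubical set with maps $1^{n}_{n+1,j}:C_n\to C_{n+1}$ ($n\ge0$, $1\le j\le n+1$; classical reflexions) and $1^{n,\gamma}_{n+1,j}:C_n\to C_{n+1}$ ($n\ge1$, $1\le j\le n$, $\gamma\in\{+,-\}$; connections) such that, whenever the maps are defined (and with $r$ denoting either $s$ everywhere or $t$ everywhere): - $1^n_{n+1,i}1^{n-1}_{n,j}=1^n_{n+1,j+1}1^{n-1}_{n,i}$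 for $1\le i\le j\le n$; - $r^n_{n-1,i}1^{n-1}_{n,j}=1^{n-2}_{n-1,j-1}r^{n-1}_{n-2,i}$ for $1\le i<j\le n$; $=1^{n-2}_{n-1,j}r^{n-1}_{n-2,i-1}$ for $1\le j<i\le n$; $=\mathrm{id}$ for $i=j$; - $1^{n,\gamma}_{n+1,i}1^{n-1,\gamma}_{n,j}=1^{n,\gamma}_{n+1,j+1}1^{n-1,\gamma}_{n,i}$ for $1\le i<j\le n-1$, and $1^{n,\gamma}_{n+1,i}1^{n-1,\gamma}_{n,i}=1^{n,\gamma}_{n+1,i+1}1^{n-1,\gamma}_{n,i}$ for $1\le i\le n-1$; - $1^{n,\gamma}_{n+1,i}1^{n-1}_{n,j}=1^n_{n+1,j+1}1^{n-1,\gamma}_{n,i}$ for $1\le i<j\le n$; $=1^n_{n+1,j}1^{n-1,\gamma}_{n,i-1}$ for $1\le j<i\le n$; and $1^{n,\gamma}_{n+1,j}1^{n-1}_{n,j}=1^n_{n+1,j}1^{n-1}_{n,j}$ for $1\le j\le n$; - $r^n_{n-1,i}1^{n-1,\gamma}_{n,j}=1^{n-2,\gamma}_{n-1,j-1}r^{n-1}_{n-2,i}$ for $1\le i<j\le n-1$; $=1^{n-2,\gamma}_{n-1,j}r^{n-1}_{n-2,i-1}$ for $2\le j+1<i\le n$; - for $1\le j\le n-1$: $s^n_{n-1,j}1^{n-1,-}_{n,j}=s^n_{n-1,j+1}1^{n-1,-}_{n,j}=\mathrm{id}$, $t^n_{n-1,j}1^{n-1,+}_{n,j}=t^n_{n-1,j+1}1^{n-1,+}_{n,j}=\mathrm{id}$,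 $s^n_{n-1,j}1^{n-1,+}_{n,j}=s^n_{n-1,j+1}1^{n-1,+}_{n,j}=1^{n-2}_{n-1,j}s^{n-1}_{n-2,j}$, $t^n_{n-1,j}1^{n-1,-}_{n,j}=t^n_{n-1,j+1}1^{n-1,-}_{n,j}=1^{n-2}_{n-1,j}t^{n-1}_{n-2,j}$. **Cubical reflexive $\infty$-magmas.** A reflexive cubical set with partial operations $\circ^n_j$ on $C_n$ ($n\ge1$, $1\le j\le n$), where $a\circ^n_jb$ is defined exactly when $t^n_{n-1,j}(a)=s^n_{n-1,j}(b)$, such that $s^n_{n-1,j}(a\circ^n_jb)=s^n_{n-1,j}(a)$, $t^n_{n-1,j}(a\circ^n_jb)=t^n_{n-1,j}(b)$, and for $r\in\{s,t\}$: $r^n_{n-1,i}(a\circ^n_jb)=r^n_{n-1,i}(a)\circ^{n-1}_{j-1}r^n_{n-1,i}(b)$ if $i<j$, and $=r^n_{n-1,i}(a)\circ^{n-1}_{j}r^n_{n-1,i}(b)$ if $j<i$. Morphisms are maps commuting with sources, targets, reflexions, connections and the operations $\circ^n_j$. **Strict cubical $\infty$-categories.** A strict cubical $\infty$-category is a cubical reflexive $\infty$-magma such that the operations are associative and unital ($1^{n-1}_{n,j}(s^n_{n-1,j}(a))\circ^n_ja=a=a\circ^n_j1^{n-1}_{n,j}(t^n_{n-1,j}(a))$), and such that: - interchange: $(a\circ^n_ib)\circ^n_j(c\circ^n_id)=(a\circ^n_jc)\circ^n_i(b\circ^n_jd)$ for $i\ne j$ whenever both sides are defined; - $1^n_{n+1,i}(a\circ^n_jb)=1^n_{n+1,i}(a)\circ^{n+1}_{j+1}1^n_{n+1,i}(b)$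 if $1\le i\le j\le n$, and $=1^n_{n+1,i}(a)\circ^{n+1}_j1^n_{n+1,i}(b)$ if $1\le j<i\le n+1$; - $1^{n,\gamma}_{n+1,i}(a\circ^n_jb)=1^{n,\gamma}_{n+1,i}(a)\circ^{n+1}_{j+1}1^{n,\gamma}_{n+1,i}(b)$ if $1\le i<j\le n$, and $=1^{n,\gamma}_{n+1,i}(a)\circ^{n+1}_j1^{n,\gamma}_{n+1,i}(b)$ if $1\le j<i\le n$; - transport laws, for $1\le j\le n$: $1^{n,+}_{n+1,j}(a\circ^n_jb)=\bigl(1^{n,+}_{n+1,j}(a)\circ^{n+1}_j1^n_{n+1,j}(a)\bigr)\circ^{n+1}_{j+1}\bigl(1^n_{n+1,j+1}(a)\circ^{n+1}_j1^{n,+}_{n+1,j}(b)\bigr)$ and $1^{n,-}_{n+1,j}(a\circ^n_jb)=\bigl(1^{n,-}_{n+1,j}(a)\circ^{n+1}_j1^n_{n+1,j+1}(b)\bigr)\circ^{n+1}_{j+1}\bigl(1^n_{n+1,j}(b)\circ^{n+1}_j1^{n,-}_{n+1,j}(b)\bigr)$; - for $1\le i\le n$: $1^{n,+}_{n+1,i}(x)\circ^{n+1}_i1^{n,-}_{n+1,i}(x)=1^n_{n+1,i+1}(x)$ and $1^{n,+}_{n+1,i}(x)\circ^{n+1}_{i+1}1^{n,-}_{n+1,i}(x)=1^n_{n+1,i}(x)$. Morphisms of strict cubical $\infty$-categories (strict cubical $\infty$-functors) are the morphisms of cubical reflexive $\infty$-magmas between them. **Cubical strict $\infty$-groupoids.**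 An $(\infty,0)$-structure on a cubical set $\mathcal C$ is a family of maps (reversors) $j^n_j:C_n\to C_n$ ($n\ge1$, $1\le j\le n$) with $t^n_{n-1,j}\circ j^n_j=s^n_{n-1,j}$ and $s^n_{n-1,j}\circ j^n_j=t^n_{n-1,j}$. A cubical strict $\infty$-groupoid is a strict cubical $\infty$-category whose underlying cubical set is equipped with an $(\infty,0)$-structure such that for all $n\ge1$, $1\le j\le n$, $\alpha\in C_n$: $\alpha\circ^n_jj^n_j(\alpha)=1^{n-1}_{n,j}(s^n_{n-1,j}(\alpha))$ and $j^n_j(\alpha)\circ^n_j\alpha=1^{n-1}_{n,j}(t^n_{n-1,j}(\alpha))$. Morphisms of cubical strict $\infty$-groupoids are the strict cubical $\infty$-functors; the category is $\infty\text{-}\mathbb{C}\mathbb{G}\mathrm{rp}$. *)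

(* Defs.v *)
(* Sets are Rocq types with Leibniz equality; proof irrelevance makes these types
   genuine sets and identifies parallel morphisms having the same underlying
   maps. *)
From Stdlib Require Import ProofIrrelevance.
From mathcomp Require Import all_boot.

Set Implicit Arguments.
Unset Strict Implicit.
Unset Printing Implicit Defensive.

(** * Categories, adjunctions, monads *)

Record category := Category {
  ob :> Type;
  hom : ob -> ob -> Type;
  idc : forall A, hom A A;
  hcomp : forall {A B C}, hom B C -> hom A B -> hom A C;
  hcomp1l : forall A B (f : hom A B), hcomp (idc B) f = f;
  hcomp1r : forall A B (f : hom A B), hcomp f (idc A) = f;
  hcompA : forall A B C D (h : hom C D) (g : hom B C) (f : hom A B),
    hcomp h (hcomp g f) = hcomp (hcomp h g) f
}.

Arguments hom {c} A B.
Arguments idc {c} A.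
Arguments hcomp {c A B C} g f.

Notation "g \oc f" := (hcomp g f) (at level 40, left associativity).

Record functor (A B : category) := Functor {
  fob :> A -> B;
  fmap : forall {X Y : A}, hom X Y -> hom (fob X) (fob Y);
  fmap1 : forall X : A, fmap (idc X) = idc (fob X);
  fmapM : forall (X Y Z : A) (g : hom Y Z) (f : hom X Y),
    fmap (g \oc f) = fmap g \oc fmap f
}.

Arguments fmap {A B} f {X Y} g : rename.

Definition functor_id (A : category) : functor A A :=
  @Functor A A (fun X => X) (fun X Y f => f)
    (fun X => erefl) (fun X Y Z g f => erefl).

Section FunctorComp.
Variables (A B C : category) (G : functor B C) (F : functor A B).

Lemma fcomp_map1 (X : A) : fmap G (fmap F (idc X)) = idc (G (F X)).
Proof. by rewrite !fmap1. Qed.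

Lemma fcomp_mapM (X Y Z : A) (g : hom Y Z) (f : hom X Y) :
  fmap G (fmap F (g \oc f)) = fmap G (fmap F g) \oc fmap G (fmap F f).
Proof. by rewrite !fmapM. Qed.

Definition functor_comp : functor A C :=
  @Functor A C (fun X => G (F X)) (fun X Y f => fmap G (fmap F f))
    fcomp_map1 fcomp_mapM.

End FunctorComp.

Record nat_trans (A B : category) (F G : functor A B) := NatTrans {
  ntc :> forall X : A, hom (F X) (G X);
  ntcP : forall (X Y : A) (f : hom X Y), ntc Y \oc fmap F f = fmap G f \oc ntc X
}.

Definition is_iso (A : category) (X Y : A) (f : hom X Y) : Prop :=
  exists g : hom Y X, g \oc f = idc X /\ f \oc g = idc Y.

Definition naturally_isomorphic (A B : category) (F G : functor A B) : Prop :=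
  exists eta : nat_trans F G, forall X, is_iso (eta X).

Definition is_equivalence (A B : category) (F : functor A B) : Prop :=
  exists G : functor B A,
    naturally_isomorphic (functor_comp G F) (functor_id A) /\
    naturally_isomorphic (functor_comp F G) (functor_id B).

Record adjunction (A B : category) (F : functor B A) (U : functor A B) :=
  Adjunction {
    adj_unit : nat_trans (functor_id B) (functor_comp U F);
    adj_counit : nat_trans (functor_comp F U) (functor_id A);
    triangleF : forall X : B,
      adj_counit (F X) \oc fmap F (adj_unit X) = idc (F X);
    triangleU : forall Y : A,
      fmap U (adj_counit Y) \oc adj_unit (U Y) = idc (U Y)
  }.

Definition is_right_adjoint (A B : category) (U : functor A B) : Prop :=
  exists F : functor B A, inhabited (adjunction F U).

Record monad (B : category) := Monad {
  mfun :> functor B B;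
  mret : nat_trans (functor_id B) mfun;
  mjoin : nat_trans (functor_comp mfun mfun) mfun;
  mjoin_retl : forall X : B, mjoin X \oc mret (mfun X) = idc (mfun X);
  mjoin_retr : forall X : B, mjoin X \oc fmap mfun (mret X) = idc (mfun X);
  mjoinA : forall X : B,
    mjoin X \oc fmap mfun (mjoin X) = mjoin X \oc mjoin (mfun X)
}.

(** ** Eilenberg-Moore category *)

Section EilenbergMoore.
Variables (B : category) (T : monad B).

Record algebra := Algebra {
  acar :> B;
  aact : hom (T acar) acar;
  aact_ret : aact \oc mret T acar = idc acar;
  aact_join : aact \oc fmap T aact = aact \oc mjoin T acar
}.

Record algebra_hom (X Y : algebra) := AlgebraHom {
  ahom :> hom (acar X) (acar Y);
  ahomP : ahom \oc aact X = aact Y \oc fmap T ahom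
}.

Lemma algebra_hom_ext (X Y : algebra) (f g : algebra_hom X Y) :
  ahom f = ahom g -> f = g.
Proof.
case: f g => [f Hf] [g Hg] /= E; subst g; congr AlgebraHom.
exact: proof_irrelevance.
Qed.

Lemma algebra_id_subproof (X : algebra) :
  idc (acar X) \oc aact X = aact X \oc fmap T (idc (acar X)).
Proof. by rewrite fmap1 hcomp1l hcomp1r. Qed.

Definition algebra_id (X : algebra) : algebra_hom X X :=
  AlgebraHom (algebra_id_subproof X).

Lemma algebra_comp_subproof (X Y Z : algebra)
    (g : algebra_hom Y Z) (f : algebra_hom X Y) :
  (ahom g \oc ahom f) \oc aact X = aact Z \oc fmap T (ahom g \oc ahom f).
Proof. by rewrite fmapM -hcompA ahomP hcompA ahomP -hcompA. Qed.

Definition algebra_comp (X Y Z : algebra)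
    (g : algebra_hom Y Z) (f : algebra_hom X Y) : algebra_hom X Z :=
  AlgebraHom (algebra_comp_subproof g f).

Lemma algebra_comp1l (X Y : algebra) (f : algebra_hom X Y) :
  algebra_comp (algebra_id Y) f = f.
Proof. by apply: algebra_hom_ext; rewrite /= hcomp1l. Qed.

Lemma algebra_comp1r (X Y : algebra) (f : algebra_hom X Y) :
  algebra_comp f (algebra_id X) = f.
Proof. by apply: algebra_hom_ext; rewrite /= hcomp1r. Qed.

Lemma algebra_compA (X Y Z W : algebra) (h : algebra_hom Z W)
    (g : algebra_hom Y Z) (f : algebra_hom X Y) :
  algebra_comp h (algebra_comp g f) = algebra_comp (algebra_comp h g) f.
Proof. by apply: algebra_hom_ext; rewrite /= hcompA. Qed.

Definition eilenberg_moore : category :=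
  @Category algebra algebra_hom algebra_id algebra_comp
    algebra_comp1l algebra_comp1r algebra_compA.

End EilenbergMoore.

(** ** Monad of an adjunction, comparison functor *)

Section Comparison.
Variables (A B : category) (F : functor B A) (U : functor A B).
Variable adj : adjunction F U.

Lemma adj_join_subproof (X Y : B) (f : hom X Y) :
  fmap U (adj_counit adj (F Y)) \oc fmap U (fmap F (fmap U (fmap F f)))
  = fmap U (fmap F f) \oc fmap U (adj_counit adj (F X)).
Proof.
by rewrite -!fmapM; congr (fmap U _); apply: (ntcP (adj_counit adj)).
Qed.

Definition adj_join :
    nat_trans (functor_comp (functor_comp U F) (functor_comp U F))
              (functor_comp U F) :=
  @NatTrans B B (functor_comp (functor_comp U F) (functor_comp U F))
    (functor_comp U F) (fun X => fmap U (adj_counit adj (F X)))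
    adj_join_subproof.

Lemma adj_retl (X : B) :
  fmap U (adj_counit adj (F X)) \oc adj_unit adj (U (F X)) = idc (U (F X)).
Proof. exact: triangleU. Qed.

Lemma adj_retr (X : B) :
  fmap U (adj_counit adj (F X)) \oc fmap U (fmap F (adj_unit adj X))
  = idc (U (F X)).
Proof. by rewrite -fmapM triangleF fmap1. Qed.

Lemma adj_act_join (Y : A) :
  fmap U (adj_counit adj Y) \oc fmap U (fmap F (fmap U (adj_counit adj Y)))
  = fmap U (adj_counit adj Y) \oc fmap U (adj_counit adj (F (U Y))).
Proof.
by rewrite -!fmapM; congr (fmap U _); apply: (ntcP (adj_counit adj)).
Qed.

Definition adj_monad : monad B :=
  @Monad B (functor_comp U F) (adj_unit adj) adj_join adj_retl adj_retr
    (fun X => adj_act_join (F X)).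

Definition comparison_ob (Y : A) : algebra adj_monad :=
  @Algebra B adj_monad (U Y) (fmap U (adj_counit adj Y))
    (triangleU adj Y) (adj_act_join Y).

Lemma comparison_map_subproof (X Y : A) (f : hom X Y) :
  fmap U f \oc fmap U (adj_counit adj X)
  = fmap U (adj_counit adj Y) \oc fmap U (fmap F (fmap U f)).
Proof.
by rewrite -!fmapM; congr (fmap U _); symmetry; apply: (ntcP (adj_counit adj)).
Qed.

Definition comparison_map (X Y : A) (f : hom X Y) :
    algebra_hom (comparison_ob X) (comparison_ob Y) :=
  @AlgebraHom B adj_monad (comparison_ob X) (comparison_ob Y) (fmap U f)
    (comparison_map_subproof f).

Lemma comparison_map1 (X : A) :
  comparison_map (idc X) = algebra_id (comparison_ob X).
Proof. by apply: algebra_hom_ext; rewrite /= fmap1. Qed.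

Lemma comparison_mapM (X Y Z : A) (g : hom Y Z) (f : hom X Y) :
  comparison_map (g \oc f) = algebra_comp (comparison_map g) (comparison_map f).
Proof. by apply: algebra_hom_ext; rewrite /= fmapM. Qed.

Definition comparison_functor : functor A (eilenberg_moore adj_monad) :=
  @Functor A (eilenberg_moore adj_monad) comparison_ob comparison_map
    comparison_map1 comparison_mapM.

End Comparison.

(* Monadicity is up to equivalence (not isomorphism) of categories. *)
Definition is_monadic (A B : category) (U : functor A B) : Prop :=
  exists (F : functor B A) (adj : adjunction F U),
    is_equivalence (comparison_functor adj).

(** * Cubical sets *)

(* Directions are counted from 0: the direction written 1 <= j <= n on paper is
   the element j - 1 of ['I_n].  To keep every index well-typed, an identity
   involving j and j - 1 (or j + 1) is stated with the smaller of the two as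
   variable. [wd j] is j viewed in the next index set, [up j] is j + 1. *)
Definition wd {n} (j : 'I_n) : 'I_n.+1 := widen_ord (leqnSn n) j.
Definition up {n} (j : 'I_n) : 'I_n.+1 := lift ord0 j.

Inductive side := Src | Tgt.
Inductive sgn := Plus | Minus.

(* [face Src j] and [face Tgt j] on [cells n.+1] are the source and the target
   in direction j; the four families of cubical identities are the four
   choices of (r, r'), with i < j on paper being i <= j here, for j shifted. *)
Record cubical_set := CubicalSet {
  cells :> nat -> Type;
  face : side -> forall {n}, 'I_n.+1 -> cells n.+1 -> cells n;
  face_face : forall (r r' : side) n (i j : 'I_n.+1) (x : cells n.+2),
    i <= j -> face r i (face r' (up j) x) = face r' j (face r (wd i) x)
}.

Arguments face {c} r {n} j x : rename.

Record cubical_map (X Y : cubical_set) := CubicalMap {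
  cmap :> forall {n}, X n -> Y n;
  cmap_face : forall r n (j : 'I_n.+1) (x : X n.+1),
    cmap (face r j x) = face r j (cmap x)
}.

Arguments cmap {X Y} f {n} x : rename.

Lemma cubical_map_ext (X Y : cubical_set) (f g : cubical_map X Y) :
  @cmap X Y f = @cmap X Y g -> f = g.
Proof.
case: f g => [f Hf] [g Hg] /= E; subst g; congr CubicalMap.
exact: proof_irrelevance.
Qed.

Definition cubical_id (X : cubical_set) : cubical_map X X :=
  @CubicalMap X X (fun n x => x) (fun r n j x => erefl).

Lemma cubical_comp_subproof (X Y Z : cubical_set)
    (g : cubical_map Y Z) (f : cubical_map X Y) r n (j : 'I_n.+1) (x : X n.+1) :
  cmap g (cmap f (face r j x)) = face r j (cmap g (cmap f x)).
Proof. by rewrite !cmap_face. Qed.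

Definition cubical_comp (X Y Z : cubical_set)
    (g : cubical_map Y Z) (f : cubical_map X Y) : cubical_map X Z :=
  @CubicalMap X Z (fun n x => cmap g (cmap f x)) (cubical_comp_subproof g f).

Lemma cubical_comp1l (X Y : cubical_set) (f : cubical_map X Y) :
  cubical_comp (cubical_id Y) f = f.
Proof. exact: cubical_map_ext. Qed.

Lemma cubical_comp1r (X Y : cubical_set) (f : cubical_map X Y) :
  cubical_comp f (cubical_id X) = f.
Proof. exact: cubical_map_ext. Qed.

Lemma cubical_compA (X Y Z W : cubical_set) (h : cubical_map Z W)
    (g : cubical_map Y Z) (f : cubical_map X Y) :
  cubical_comp h (cubical_comp g f) = cubical_comp (cubical_comp h g) f.
Proof. exact: cubical_map_ext. Qed.

Definition CSets : category :=
  @Category cubical_set cubical_map cubical_id cubical_comp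
    cubical_comp1l cubical_comp1r cubical_compA.

(** * Reflexive cubical sets *)

(* [refl j] is the classical reflexion 1_j and [conn g j] the connection
   1^g_j. [conn] lives on cells of dimension n >= 1 since ['I_0] is empty. *)
Record reflexive_cubical_set := ReflexiveCubicalSet {
  rcs_cubical_set :> cubical_set;
  refl : forall {n}, 'I_n.+1 -> rcs_cubical_set n -> rcs_cubical_set n.+1;
  conn : sgn -> forall {n}, 'I_n -> rcs_cubical_set n -> rcs_cubical_set n.+1;

  refl_refl : forall n (i j : 'I_n.+1) (x : rcs_cubical_set n),
    i <= j -> refl (wd i) (refl j x) = refl (up j) (refl i x);

  face_refl_lt : forall r n (i j : 'I_n.+1) (x : rcs_cubical_set n.+1),
    i <= j -> face r (wd i) (refl (up j) x) = refl j (face r i x);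
  face_refl_gt : forall r n (i j : 'I_n.+1) (x : rcs_cubical_set n.+1),
    j <= i -> face r (up i) (refl (wd j) x) = refl j (face r i x);
  face_refl_eq : forall r n (j : 'I_n.+1) (x : rcs_cubical_set n),
    face r j (refl j x) = x;

  (* i < j and i = j together *)
  conn_conn : forall g n (i j : 'I_n) (x : rcs_cubical_set n),
    i <= j -> conn g (wd i) (conn g j x) = conn g (up j) (conn g i x);

  conn_refl_lt : forall g n (i : 'I_n) (j : 'I_n.+1) (x : rcs_cubical_set n),
    i < j -> conn g (wd i) (refl j x) = refl (up j) (conn g i x);
  conn_refl_gt : forall g n (i : 'I_n) (j : 'I_n.+1) (x : rcs_cubical_set n),
    j <= i -> conn g (up i) (refl j x) = refl (wd j) (conn g i x);
  conn_refl_eq : forall g n (j : 'I_n.+1) (x : rcs_cubical_set n),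
    conn g j (refl j x) = refl (wd j) (refl j x);

  face_conn_lt : forall r g n (i : 'I_n.+1) (j : 'I_n)
      (x : rcs_cubical_set n.+1),
    i <= j -> face r (wd i) (conn g (up j) x) = conn g j (face r i x);
  face_conn_gt : forall r g n (i : 'I_n.+1) (j : 'I_n)
      (x : rcs_cubical_set n.+1),
    j < i -> face r (up i) (conn g (wd j) x) = conn g j (face r i x);

  src_conn_minus : forall n (j : 'I_n.+1) (x : rcs_cubical_set n.+1),
    face Src (wd j) (conn Minus j x) = x /\
    face Src (up j) (conn Minus j x) = x;
  tgt_conn_plus : forall n (j : 'I_n.+1) (x : rcs_cubical_set n.+1),
    face Tgt (wd j) (conn Plus j x) = x /\
    face Tgt (up j) (conn Plus j x) = x;
  src_conn_plus : forall n (j : 'I_n.+1) (x : rcs_cubical_set n.+1),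
    face Src (wd j) (conn Plus j x) = refl j (face Src j x) /\
    face Src (up j) (conn Plus j x) = refl j (face Src j x);
  tgt_conn_minus : forall n (j : 'I_n.+1) (x : rcs_cubical_set n.+1),
    face Tgt (wd j) (conn Minus j x) = refl j (face Tgt j x) /\
    face Tgt (up j) (conn Minus j x) = refl j (face Tgt j x)
}.

Arguments refl {r n} j x : rename.
Arguments conn {r} g {n} j x : rename.

(** * Cubical reflexive infinity-magmas *)

(* The partial composition a o_j b is a function of a, b and a proof that it is
   defined. An equation one of whose composites is asserted to be defined is
   written [exists h, ... = ccomp j a b h]; by proof irrelevance the value does
   not depend on h. *)
Unset Implicit Arguments.

Record cubical_magma := CubicalMagma {
  magma_rcs :> reflexive_cubical_set;
  ccomp : forall {n} (j : 'I_n.+1) (a b : magma_rcs n.+1),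
    face Tgt j a = face Src j b -> magma_rcs n.+1;

  src_ccomp : forall n (j : 'I_n.+1) (a b : magma_rcs n.+1)
      (h : face Tgt j a = face Src j b),
    face Src j (ccomp j a b h) = face Src j a;
  tgt_ccomp : forall n (j : 'I_n.+1) (a b : magma_rcs n.+1)
      (h : face Tgt j a = face Src j b),
    face Tgt j (ccomp j a b h) = face Tgt j b;
  face_ccomp_lt : forall r n (i j : 'I_n.+1) (a b : magma_rcs n.+2)
      (h : face Tgt (up j) a = face Src (up j) b),
    i <= j -> exists h',
      face r (wd i) (ccomp (up j) a b h)
      = ccomp j (face r (wd i) a) (face r (wd i) b) h';
  face_ccomp_gt : forall r n (i j : 'I_n.+1) (a b : magma_rcs n.+2)
      (h : face Tgt (wd j) a = face Src (wd j) b),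
    j <= i -> exists h',
      face r (up i) (ccomp (wd j) a b h)
      = ccomp j (face r (up i) a) (face r (up i) b) h'
}.

Arguments ccomp {m n} j a b h : rename.

Record magma_map (X Y : cubical_magma) := MagmaMap {
  magma_cmap :> cubical_map X Y;
  magma_map_refl : forall n (j : 'I_n.+1) (x : X n),
    magma_cmap _ (refl j x) = refl j (magma_cmap _ x);
  magma_map_conn : forall g n (j : 'I_n) (x : X n),
    magma_cmap _ (conn g j x) = conn g j (magma_cmap _ x);
  magma_map_ccomp : forall n (j : 'I_n.+1) (a b : X n.+1)
      (h : face Tgt j a = face Src j b), exists h',
    magma_cmap _ (ccomp j a b h) = ccomp j (magma_cmap _ a) (magma_cmap _ b) h'
}.

Arguments magma_cmap {X Y} f : rename.

(** * Strict cubical infinity-categories *)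

Record strict_category := StrictCategory {
  sc_magma :> cubical_magma;

  ccompA : forall n (j : 'I_n.+1) (a b c : sc_magma n.+1) hab hbc,
    exists h1 h2,
      ccomp j (ccomp j a b hab) c h1 = ccomp j a (ccomp j b c hbc) h2;
  ccomp1l : forall n (j : 'I_n.+1) (a : sc_magma n.+1), exists h,
    ccomp j (refl j (face Src j a)) a h = a;
  ccomp1r : forall n (j : 'I_n.+1) (a : sc_magma n.+1), exists h,
    ccomp j a (refl j (face Tgt j a)) h = a;

  ccomp_interchange : forall n (i j : 'I_n.+1) (a b c d : sc_magma n.+1)
      hab hcd h hac hbd h',
    i != j ->
    ccomp j (ccomp i a b hab) (ccomp i c d hcd) h
    = ccomp i (ccomp j a c hac) (ccomp j b d hbd) h';

  refl_ccomp_le : forall n (i : 'I_n.+2) (j : 'I_n.+1)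
      (a b : sc_magma n.+1) h,
    i <= j -> exists h',
      refl i (ccomp j a b h) = ccomp (up j) (refl i a) (refl i b) h';
  refl_ccomp_gt : forall n (i : 'I_n.+2) (j : 'I_n.+1)
      (a b : sc_magma n.+1) h,
    j < i -> exists h',
      refl i (ccomp j a b h) = ccomp (wd j) (refl i a) (refl i b) h';

  conn_ccomp_lt : forall g n (i j : 'I_n.+1) (a b : sc_magma n.+1) h,
    i < j -> exists h',
      conn g i (ccomp j a b h) = ccomp (up j) (conn g i a) (conn g i b) h';
  conn_ccomp_gt : forall g n (i j : 'I_n.+1) (a b : sc_magma n.+1) h,
    j < i -> exists h',
      conn g i (ccomp j a b h) = ccomp (wd j) (conn g i a) (conn g i b) h';

  transport_plus : forall n (j : 'I_n.+1) (a b : sc_magma n.+1) h,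
    exists h1 h2 h3,
      conn Plus j (ccomp j a b h)
      = ccomp (up j)
          (ccomp (wd j) (conn Plus j a) (refl (wd j) a) h1)
          (ccomp (wd j) (refl (up j) a) (conn Plus j b) h2) h3;
  transport_minus : forall n (j : 'I_n.+1) (a b : sc_magma n.+1) h,
    exists h1 h2 h3,
      conn Minus j (ccomp j a b h)
      = ccomp (up j)
          (ccomp (wd j) (conn Minus j a) (refl (up j) b) h1)
          (ccomp (wd j) (refl (wd j) b) (conn Minus j b) h2) h3;

  ccomp_conn_same : forall n (i : 'I_n.+1) (x : sc_magma n.+1), exists h,
    ccomp (wd i) (conn Plus i x) (conn Minus i x) h = refl (up i) x;
  ccomp_conn_next : forall n (i : 'I_n.+1) (x : sc_magma n.+1), exists h,
    ccomp (up i) (conn Plus i x) (conn Minus i x) h = refl (wd i) x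
}.

(** * Cubical strict infinity-groupoids *)

Record strict_groupoid := StrictGroupoid {
  sg_category :> strict_category;
  reversor : forall {n}, 'I_n.+1 -> sg_category n.+1 -> sg_category n.+1;
  tgt_rev : forall n (j : 'I_n.+1) (a : sg_category n.+1),
    face Tgt j (reversor j a) = face Src j a;
  src_rev : forall n (j : 'I_n.+1) (a : sg_category n.+1),
    face Src j (reversor j a) = face Tgt j a;
  ccomp_revr : forall n (j : 'I_n.+1) (a : sg_category n.+1), exists h,
    ccomp j a (reversor j a) h = refl j (face Src j a);
  ccomp_revl : forall n (j : 'I_n.+1) (a : sg_category n.+1), exists h,
    ccomp j (reversor j a) a h = refl j (face Tgt j a)
}.

Arguments reversor {s n} j a : rename.

Set Implicit Arguments.

Lemma magma_map_ext (X Y : cubical_magma) (f g : magma_map X Y) :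
  magma_cmap f = magma_cmap g -> f = g.
Proof.
case: f g => [f H1 H2 H3] [g K1 K2 K3] /= E; subst g.
by congr MagmaMap; apply: proof_irrelevance.
Qed.

Section MagmaMaps.
Variables (X Y Z : cubical_magma) (g : magma_map Y Z) (f : magma_map X Y).
Let gf : cubical_map X Z := cubical_comp g f.

Lemma magma_id_ccomp n (j : 'I_n.+1) (a b : X n.+1)
    (h : face Tgt j a = face Src j b) : exists h',
  cubical_id X _ (ccomp j a b h)
  = ccomp j (cubical_id X _ a) (cubical_id X _ b) h'.
Proof. by exists h. Qed.

Lemma magma_comp_refl n (j : 'I_n.+1) (x : X n) :
  gf _ (refl j x) = refl j (gf _ x).
Proof. by rewrite /= !magma_map_refl. Qed.

Lemma magma_comp_conn s n (j : 'I_n) (x : X n) :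
  gf _ (conn s j x) = conn s j (gf _ x).
Proof. by rewrite /= !magma_map_conn. Qed.

Lemma magma_comp_ccomp n (j : 'I_n.+1) (a b : X n.+1)
    (h : face Tgt j a = face Src j b) : exists h',
  gf _ (ccomp j a b h) = ccomp j (gf _ a) (gf _ b) h'.
Proof.
have [h1 E1] := magma_map_ccomp _ _ f _ _ _ _ h.
have [h2 E2] := magma_map_ccomp _ _ g _ _ _ _ h1.
by exists h2; rewrite /= E1 E2.
Qed.

Definition magma_id : magma_map X X :=
  @MagmaMap X X (cubical_id X) (fun n j x => erefl) (fun s n j x => erefl)
    magma_id_ccomp.

Definition magma_comp : magma_map X Z :=
  @MagmaMap X Z gf magma_comp_refl magma_comp_conn magma_comp_ccomp.

End MagmaMaps.

Lemma magma_comp1l (X Y : cubical_magma) (f : magma_map X Y) :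
  magma_comp (magma_id Y) f = f.
Proof. by apply: magma_map_ext; apply: cubical_map_ext. Qed.

Lemma magma_comp1r (X Y : cubical_magma) (f : magma_map X Y) :
  magma_comp f (magma_id X) = f.
Proof. by apply: magma_map_ext; apply: cubical_map_ext. Qed.

Lemma magma_compA (X Y Z W : cubical_magma) (h : magma_map Z W)
    (g : magma_map Y Z) (f : magma_map X Y) :
  magma_comp h (magma_comp g f) = magma_comp (magma_comp h g) f.
Proof. by apply: magma_map_ext; apply: cubical_map_ext. Qed.

(* Morphisms are the strict cubical infinity-functors; preservation of the
   reversors is not part of the definition. *)
Definition CGrp : category :=
  @Category strict_groupoid (fun X Y => magma_map X Y)
    (fun X => magma_id X) (fun X Y Z g f => magma_comp g f)
    (fun X Y f => magma_comp1l f) (fun X Y f => magma_comp1r f)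
    (fun X Y Z W h g f => magma_compA h g f).

Definition forget : functor CGrp CSets :=
  @Functor CGrp CSets
    (fun X : strict_groupoid => X : cubical_set)
    (fun X Y (f : magma_map X Y) => magma_cmap f : cubical_map X Y)
    (fun X => erefl) (fun X Y Z g f => erefl).

(* Main.v *)
From Stdlib Require Import FunctionalExtensionality PropExtensionality.
From Stdlib Require Import ProofIrrelevance ClassicalEpsilon.
From mathcomp Require Import all_boot.
Require Import Defs.

Set Implicit Arguments.
Unset Strict Implicit.
Unset Printing Implicit Defensive.

(** A strict cubical groupoid is a model of a theory whose operations have
    cubical sets as arities: a composite takes as input a pair of cells matching
    along a face, and this condition only involves the underlying cubical set.
    Hence groupoids are to cubical sets what the algebras of an equational
    theory are to sets, and the same argument gives the free models and the
    monadicity.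

    The free groupoid on X consists of formal terms over X. A composite is not
    always defined, so terms are interpreted by their values in all groupoids Y
    under all cubical maps from X to Y: a term is well formed when its
    composites are defined in all these interpretations, and two terms are equal
    when all interpretations identify them. Both conditions are propositions, so
    quantifying over all groupoids does not raise the universe level. The classes of well formed
    terms, called words, form a cubical set [words X], and by construction the
    interpretations [wext f] detect equality of words ([wext_inj]) and
    definedness of composites. Substitution ([bind]) makes [words] the Kleisli
    form of a monad.

    The central step is that every algebra alpha : words C -> C of this monad
    carries a groupoid structure: apply an operation formally to generators, then
    alpha. The algebra law says that alpha commutes with the operations
    ([alpha_refl], [alpha_conn], [alpha_comp]), so both sides of an axiom at
    cells of C are images under alpha of words over C; these words are equal
    because the axiom holds in every interpretation ([alpha_eq],
    [alpha_comp_eq], [alpha_comp_square]).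

    Applied to the multiplication words (words X) -> words X, this turns the
    words themselves into a groupoid [free X]. It is free on X: a functor out of
    it is determined on terms by induction ([free_ext_uniq]), where formal
    inverses are covered by uniqueness of inverses ([magma_map_rev]). Applied to
    an arbitrary Eilenberg-Moore algebra, it gives a quasi-inverse of the
    comparison functor. Both natural isomorphisms are the identity on cells: the
    operations that a groupoid Y gets back from its counit words Y -> Y are its
    own ([from_comparison]), and the counit of the groupoid of an algebra is the
    given structure map ([structure_counit]). *)

(** * Composites and their definedness proofs *)

Lemma ccomp_congr (M : cubical_magma) n (j : 'I_n.+1) (a b a' b' : M n.+1)
    (h : face Tgt j a = face Src j b) (h' : face Tgt j a' = face Src j b') :
  a = a' -> b = b' -> ccomp j a b h = ccomp j a' b' h'.
Proof.
by move=> Ea Eb; subst a' b'; congr ccomp; apply: proof_irrelevance.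
Qed.

(** Total composition lets every formal term be evaluated by plain recursion; the
    value [a] of an undefined composite is arbitrary, as well-formedness excludes
    these terms. *)
Definition total_comp (M : cubical_magma) n (j : 'I_n.+1) (a b : M n.+1) : M n.+1 :=
  match excluded_middle_informative (face Tgt j a = face Src j b) with
  | left h => ccomp j a b h
  | right _ => a
  end.

Lemma total_compE (M : cubical_magma) n (j : 'I_n.+1) (a b : M n.+1)
    (h : face Tgt j a = face Src j b) : total_comp j a b = ccomp j a b h.
Proof.
by rewrite /total_comp; case: excluded_middle_informative => // h'; apply: ccomp_congr.
Qed.

(** * Words over a cubical set *)

Section Words.
Variable X : cubical_set.

(** Faces are formal operations too, so the cubical and face identities need not
    be oriented into a computation of the faces of a term: they hold between
    classes of terms. *)
Inductive term : nat -> Type :=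
| Gen n of X n : term n
| Face n of side & 'I_n.+1 & term n.+1 : term n
| Refl n of 'I_n.+1 & term n : term n.+1
| Conn n of sgn & 'I_n & term n : term n.+1
| Comp n of 'I_n.+1 & term n.+1 & term n.+1 : term n.+1
| Rev n of 'I_n.+1 & term n.+1 : term n.+1.

Fixpoint ev (Y : strict_groupoid) (f : cubical_map X Y) n (t : term n) : Y n :=
  match t with
  | Gen _ x => cmap f x
  | Face _ r j s => face r j (ev f s)
  | Refl _ j s => refl j (ev f s)
  | Conn _ g j s => conn g j (ev f s)
  | Comp _ j s u => total_comp j (ev f s) (ev f u)
  | Rev _ j s => reversor j (ev f s)
  end.

(** Definedness of a composite refers to all interpretations, not to a derivation
    of the matching of faces: this semantic condition replaces a deductive system
    for partial terms. *)
Fixpoint wf n (t : term n) : Prop :=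
  match t with
  | Gen _ _ => True
  | Face _ _ _ s | Refl _ _ s | Conn _ _ _ s | Rev _ _ s => wf s
  | Comp _ j s u => [/\ wf s, wf u &
      forall (Y : strict_groupoid) (f : cubical_map X Y),
        face Tgt j (ev f s) = face Src j (ev f u)]
  end.

Definition teq n (s t : term n) : Prop :=
  forall (Y : strict_groupoid) (f : cubical_map X Y), ev f s = ev f t.

Definition word n := {P : term n -> Prop | exists2 t, wf t & P = teq t}.

Definition class n (t : term n) (wt : wf t) : word n :=
  exist _ (teq t) (ex_intro2 _ _ t wt erefl).

Definition repr n (w : word n) : term n :=
  proj1_sig (constructive_indefinite_description _
    (let: ex_intro2 t wt e := proj2_sig w in ex_intro _ t (conj wt e))).

Lemma repr_wf n (w : word n) : wf (repr w).
Proof. by rewrite /repr; case: constructive_indefinite_description => ? []. Qed.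

Lemma repr_teq n (w : word n) : proj1_sig w = teq (repr w).
Proof. by rewrite /repr; case: constructive_indefinite_description => ? []. Qed.

Definition extend (Y : strict_groupoid) (f : cubical_map X Y) n (w : word n) :=
  ev f (repr w).

Lemma extend_class (Y : strict_groupoid) (f : cubical_map X Y) n (t : term n)
    (wt : wf t) : extend f (class wt) = ev f t.
Proof.
have E : teq t = teq (repr (class wt)) := repr_teq (class wt).
have {E} : teq (repr (class wt)) t by rewrite -E.
exact.
Qed.

(** Words are a part of the product of all their interpretations, and hence
    inherit identities from groupoids. *)
Lemma extend_inj n (v w : word n) :
  (forall (Y : strict_groupoid) (f : cubical_map X Y), extend f v = extend f w) ->
  v = w.
Proof.
move=> E; have {E} : proj1_sig v = proj1_sig w.
  rewrite !repr_teq; apply: functional_extensionality => t.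
  by apply: propositional_extensionality; split=> H Y f;
     rewrite -(H Y f); [symmetry|]; apply: E.
case: v w => [P hP] [Q hQ] /= E; subst Q; congr exist.
exact: proof_irrelevance.
Qed.

(** The operations choose representatives; [extend_face] and the [wext] lemmas
    below show that the choice does not matter. *)
Definition word_face r n (j : 'I_n.+1) (w : word n.+1) : word n :=
  @class n (Face r j (repr w)) (repr_wf w).

Lemma word_face_face (r r' : side) n (i j : 'I_n.+1) (w : word n.+2) :
  i <= j -> word_face r i (word_face r' (up j) w)
            = word_face r' j (word_face r (wd i) w).
Proof.
move=> le_ij; apply: extend_inj => Y f; rewrite !extend_class /=.
rewrite -!/(extend _ _) !extend_class /=; exact: face_face.
Qed.

Definition words : cubical_set := CubicalSet word_face_face.

Lemma extend_face (Y : strict_groupoid) (f : cubical_map X Y) r n (j : 'I_n.+1)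
    (w : words n.+1) : extend f (face r j w) = face r j (extend f w).
Proof. exact: extend_class. Qed.

Definition wext (Y : strict_groupoid) (f : cubical_map X Y) :
    cubical_map words Y := CubicalMap (extend_face f).

Lemma wext_class (Y : strict_groupoid) (f : cubical_map X Y) n (t : term n)
    (wt : wf t) : cmap (wext f) (class wt : words n) = ev f t.
Proof. exact: extend_class. Qed.

Lemma wext_inj n (v w : words n) :
  (forall (Y : strict_groupoid) (f : cubical_map X Y),
     cmap (wext f) v = cmap (wext f) w) -> v = w.
Proof. exact: extend_inj. Qed.

Definition wrefl n (j : 'I_n.+1) (w : words n) : words n.+1 :=
  @class n.+1 (Refl j (repr w)) (repr_wf w).
Definition wconn g n (j : 'I_n) (w : words n) : words n.+1 :=
  @class n.+1 (Conn g j (repr w)) (repr_wf w).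
Definition wrev n (j : 'I_n.+1) (w : words n.+1) : words n.+1 :=
  @class n.+1 (Rev j (repr w)) (repr_wf w).

Lemma Comp_repr_wf n (j : 'I_n.+1) (v w : words n.+1) :
  face Tgt j v = face Src j w -> wf (Comp j (repr v) (repr w)).
Proof.
move=> E; split=> [||Y f]; try exact: repr_wf.
by rewrite -!/(extend _ _) -!extend_face E.
Qed.

(** The composite of words is total as well, with a default value in the
    undefined case, which keeps definedness proofs out of iterated composites. *)
Definition wcomp n (j : 'I_n.+1) (v w : words n.+1) : words n.+1 :=
  match excluded_middle_informative (face Tgt j v = face Src j w) with
  | left h => class (Comp_repr_wf h)
  | right _ => v
  end.

Section Wext.
Variables (Y : strict_groupoid) (f : cubical_map X Y).

Lemma wext_refl n (j : 'I_n.+1) (w : words n) :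
  cmap (wext f) (wrefl j w) = refl j (cmap (wext f) w).
Proof. exact: extend_class. Qed.

Lemma wext_conn g n (j : 'I_n) (w : words n) :
  cmap (wext f) (wconn g j w) = conn g j (cmap (wext f) w).
Proof. exact: extend_class. Qed.

Lemma wext_rev n (j : 'I_n.+1) (w : words n.+1) :
  cmap (wext f) (wrev j w) = reversor j (cmap (wext f) w).
Proof. exact: extend_class. Qed.

Lemma wext_comp n (j : 'I_n.+1) (v w : words n.+1)
    (h : face Tgt j v = face Src j w) h' :
  cmap (wext f) (wcomp j v w) = ccomp j (cmap (wext f) v) (cmap (wext f) w) h'.
Proof.
rewrite /wcomp; case: excluded_middle_informative => // k.
by rewrite -total_compE; apply: extend_class.
Qed.

Lemma wext_comp_ex n (j : 'I_n.+1) (v w : words n.+1) :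
  face Tgt j v = face Src j w -> exists h',
  cmap (wext f) (wcomp j v w) = ccomp j (cmap (wext f) v) (cmap (wext f) w) h'.
Proof.
move=> h; have h' := congr1 (fun x => cmap (wext f) x) h.
move: h'; rewrite !cmap_face => h'; exists h'; exact: wext_comp.
Qed.

End Wext.

Definition gen n (x : X n) : words n := @class n (Gen x) I.

Lemma wext_gen (Y : strict_groupoid) (f : cubical_map X Y) n (x : X n) :
  cmap (wext f) (gen x) = cmap f x.
Proof. exact: extend_class. Qed.

Lemma gen_face r n (j : 'I_n.+1) (x : X n.+1) :
  gen (face r j x) = face r j (gen x).
Proof. by apply: wext_inj => Y f; rewrite cmap_face !wext_gen cmap_face. Qed.

Definition wunit : cubical_map X words := CubicalMap gen_face.

Lemma wext_unit (Y : strict_groupoid) (f : cubical_map X Y) n (x : X n) :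
  cmap (wext f) (cmap wunit x) = cmap f x.
Proof. exact: wext_gen. Qed.

End Words.

(** * Substitution of words *)

Section Bind.
Variables (X Z : cubical_set) (k : cubical_map X (words Z)).

Fixpoint subst n (t : term X n) : term Z n :=
  match t with
  | Gen _ x => repr (cmap k x)
  | Face _ r j s => Face r j (subst s)
  | Refl _ j s => Refl j (subst s)
  | Conn _ g j s => Conn g j (subst s)
  | Comp _ j s u => Comp j (subst s) (subst u)
  | Rev _ j s => Rev j (subst s)
  end.

(** Interpreting after a substitution amounts to interpreting along the composite
    map; every law about [bind] reduces to this one through [wext_inj]. *)
Lemma ev_subst (Y : strict_groupoid) (f : cubical_map Z Y) n (t : term X n) :
  ev f (subst t) = ev (cubical_comp (wext f) k) t.
Proof. by elim: t => //= [m r j s ->|m j s ->|m g j s ->|m j s -> u ->|m j s ->]. Qed.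

Lemma wf_subst n (t : term X n) : wf t -> wf (subst t).
Proof.
elim: t => //= [m x _|m j s IHs u IHu [/IHs ws /IHu wu E]]; first exact: repr_wf.
by split=> // Y f; rewrite !ev_subst.
Qed.

Definition bind_fun n (w : words X n) : words Z n := class (wf_subst (repr_wf w)).

Lemma wext_bind_fun (Y : strict_groupoid) (f : cubical_map Z Y) n (w : words X n) :
  cmap (wext f) (bind_fun w) = cmap (wext (cubical_comp (wext f) k)) w.
Proof. by rewrite -[RHS]ev_subst; apply: extend_class. Qed.

Lemma bind_face r n (j : 'I_n.+1) (w : words X n.+1) :
  bind_fun (face r j w) = face r j (bind_fun w).
Proof.
by apply: wext_inj => Y f; rewrite cmap_face !wext_bind_fun cmap_face.
Qed.

Definition bind : cubical_map (words X) (words Z) := CubicalMap bind_face.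

Lemma wext_bind (Y : strict_groupoid) (f : cubical_map Z Y) n (w : words X n) :
  cmap (wext f) (cmap bind w) = cmap (wext (cubical_comp (wext f) k)) w.
Proof. exact: wext_bind_fun. Qed.

Lemma bind_unit n (x : X n) : cmap bind (cmap (wunit X) x) = cmap k x.
Proof. by apply: wext_inj => Y f; rewrite wext_bind wext_unit. Qed.

Lemma bind_refl n (j : 'I_n.+1) (w : words X n) :
  cmap bind (wrefl j w) = wrefl j (cmap bind w).
Proof. by apply: wext_inj => Y f; rewrite !(wext_refl, wext_bind). Qed.

Lemma bind_conn g n (j : 'I_n) (w : words X n) :
  cmap bind (wconn g j w) = wconn g j (cmap bind w).
Proof. by apply: wext_inj => Y f; rewrite !(wext_conn, wext_bind). Qed.

Lemma bind_rev n (j : 'I_n.+1) (w : words X n.+1) :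
  cmap bind (wrev j w) = wrev j (cmap bind w).
Proof. by apply: wext_inj => Y f; rewrite !(wext_rev, wext_bind). Qed.

Lemma bind_comp n (j : 'I_n.+1) (v w : words X n.+1) :
  face Tgt j v = face Src j w ->
  cmap bind (wcomp j v w) = wcomp j (cmap bind v) (cmap bind w).
Proof.
move=> h; have hb : face Tgt j (cmap bind v) = face Src j (cmap bind w).
  by rewrite -!cmap_face h.
apply: wext_inj => Y f; rewrite wext_bind.
have [h1 ->] := wext_comp_ex f hb.
have [h2 ->] := wext_comp_ex (cubical_comp (wext f) k) h.
by apply: ccomp_congr; rewrite wext_bind.
Qed.

End Bind.

(** * From algebras to groupoids *)

Lemma lt_ord_wd_up n (i j : 'I_n.+2) :
  i < j -> exists i' j' : 'I_n.+1, [/\ i = wd i', j = up j' & i' <= j'].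
Proof.
move=> lt_ij; have lt_in : i < n.+1 by apply: leq_trans lt_ij _; rewrite -ltnS.
case: j lt_ij => [[//|j] lt_j] /= lt_ij.
exists (Ordinal lt_in), (Ordinal (lt_j : j < n.+1)); split=> //; exact: val_inj.
Qed.

(** If the four cells match as in a two by two grid, the composites in direction
    i match in direction j, because the faces in direction j of such a composite
    are the composites of the faces. *)
Lemma interchange_composable (M : cubical_magma) n (i j : 'I_n.+1)
    (a b c d : M n.+1) (hab : face Tgt i a = face Src i b)
    (hcd : face Tgt i c = face Src i d) :
  i != j -> face Tgt j a = face Src j c -> face Tgt j b = face Src j d ->
  face Tgt j (ccomp i a b hab) = face Src j (ccomp i c d hcd).
Proof.
case: n => [|n] in i j a b c d hab hcd *.
  by move=> /eqP[]; rewrite [i]ord1 [j]ord1.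
rewrite neq_ltn => /orP[] /lt_ord_wd_up [i' [j' [Ei Ej le_ij]]] hac hbd; subst i j.
  have [h1 ->] := face_ccomp_gt _ Tgt _ _ _ _ _ hab le_ij.
  have [h2 ->] := face_ccomp_gt _ Src _ _ _ _ _ hcd le_ij.
  exact: ccomp_congr.
have [h1 ->] := face_ccomp_lt _ Tgt _ _ _ _ _ hab le_ij.
have [h2 ->] := face_ccomp_lt _ Src _ _ _ _ _ hcd le_ij.
exact: ccomp_congr.
Qed.

Section AlgebraGroupoid.
Variables (C : cubical_set) (alpha : cubical_map (words C) C).
Hypothesis alpha_unit : forall n (c : C n), cmap alpha (cmap (wunit C) c) = c.
Hypothesis alpha_bind : forall n (w : words (words C) n),
  cmap alpha (cmap (bind (cubical_id (words C))) w)
  = cmap alpha (cmap (bind (cubical_comp (wunit C) alpha)) w).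

Let u n (c : C n) : words C n := cmap (wunit C) c.

(** The operations on [C] are the formal ones on generators, evaluated by
    [alpha]. *)
Definition alg_refl n (j : 'I_n.+1) (c : C n) : C n.+1 := cmap alpha (wrefl j (u c)).
Definition alg_conn g n (j : 'I_n) (c : C n) : C n.+1 := cmap alpha (wconn g j (u c)).
Definition alg_rev n (j : 'I_n.+1) (c : C n.+1) : C n.+1 := cmap alpha (wrev j (u c)).
Definition alg_comp n (j : 'I_n.+1) (a b : C n.+1) : C n.+1 :=
  cmap alpha (wcomp j (u a) (u b)).

(** The algebra law, applied to the formal reflexion of the word [w] taken as a
    generator, says that [alpha] commutes with reflexions. *)
Lemma alpha_refl n (j : 'I_n.+1) (w : words C n) :
  alg_refl j (cmap alpha w) = cmap alpha (wrefl j w).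
Proof.
have := alpha_bind (wrefl j (cmap (wunit _) w)).
by rewrite !bind_refl !bind_unit.
Qed.

Lemma alpha_conn g n (j : 'I_n) (w : words C n) :
  alg_conn g j (cmap alpha w) = cmap alpha (wconn g j w).
Proof.
have := alpha_bind (wconn g j (cmap (wunit _) w)).
by rewrite !bind_conn !bind_unit.
Qed.

Lemma alpha_comp n (j : 'I_n.+1) (v w : words C n.+1) :
  face Tgt j v = face Src j w ->
  alg_comp j (cmap alpha v) (cmap alpha w) = cmap alpha (wcomp j v w).
Proof.
move=> h; have hu : face Tgt j (cmap (wunit _) v) = face Src j (cmap (wunit _) w).
  by rewrite -!cmap_face h.
by have := alpha_bind (wcomp j (cmap (wunit _) v) (cmap (wunit _) w));
   rewrite !bind_comp // !bind_unit.
Qed.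

Lemma alpha_eq n (v w : words C n) :
  (forall (Y : strict_groupoid) (f : cubical_map C Y),
     cmap (wext f) v = cmap (wext f) w) -> cmap alpha v = cmap alpha w.
Proof. by move=> /wext_inj ->. Qed.

Lemma unit_composable n (j : 'I_n.+1) (a b : C n.+1) :
  face Tgt j a = face Src j b -> face Tgt j (u a) = face Src j (u b).
Proof. by move=> h; rewrite -!cmap_face h. Qed.

Lemma model_composable (Y : strict_groupoid) (f : cubical_map C Y) n
    (j : 'I_n.+1) (a b : C n.+1) :
  face Tgt j a = face Src j b ->
  face Tgt j (cmap f a) = face Src j (cmap f b).
Proof. by move=> h; rewrite -!cmap_face h. Qed.

(** The composites of generators are interpreted as composites in the model,
    with a definedness proof that comes from [C]. *)
Lemma model_comp (Y : strict_groupoid) (f : cubical_map C Y) n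
    (j : 'I_n.+1) (a b : C n.+1) (h : face Tgt j a = face Src j b) :
  cmap (wext f) (wcomp j (u a) (u b))
  = ccomp j (cmap f a) (cmap f b) (model_composable f h).
Proof.
have [h' ->] := wext_comp_ex f (unit_composable h).
by apply: ccomp_congr; rewrite wext_unit.
Qed.

(** An identity asserting that a composite of two words is defined and equal to
    a third word passes from all interpretations to [C]. *)
Lemma alpha_comp_eq n (j : 'I_n.+1) (v w x : words C n.+1) :
  (forall (Y : strict_groupoid) (f : cubical_map C Y), exists h,
     ccomp j (cmap (wext f) v) (cmap (wext f) w) h = cmap (wext f) x) ->
  face Tgt j (cmap alpha v) = face Src j (cmap alpha w) /\
  alg_comp j (cmap alpha v) (cmap alpha w) = cmap alpha x.
Proof.
move=> E; have h : face Tgt j v = face Src j w.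
  by apply: wext_inj => Y f; have [h _] := E Y f; rewrite !cmap_face.
split; first by rewrite -!cmap_face h.
rewrite alpha_comp //; apply: alpha_eq => Y f.
have [h1 <-] := E Y f; exact: wext_comp.
Qed.

Ltac models := apply: alpha_eq => Y f;
  rewrite ?(wext_refl, wext_conn, wext_rev, wext_unit, cmap_face).

Lemma alg_refl_refl n (i j : 'I_n.+1) (x : C n) :
  i <= j -> alg_refl (wd i) (alg_refl j x) = alg_refl (up j) (alg_refl i x).
Proof. move=> H; rewrite !alpha_refl; models; exact: refl_refl. Qed.

Lemma alg_face_refl_lt r n (i j : 'I_n.+1) (x : C n.+1) :
  i <= j -> face r (wd i) (alg_refl (up j) x) = alg_refl j (face r i x).
Proof. move=> H; rewrite -cmap_face; models; exact: face_refl_lt. Qed.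

Lemma alg_face_refl_gt r n (i j : 'I_n.+1) (x : C n.+1) :
  j <= i -> face r (up i) (alg_refl (wd j) x) = alg_refl j (face r i x).
Proof. move=> H; rewrite -cmap_face; models; exact: face_refl_gt. Qed.

Lemma alg_face_refl_eq r n (j : 'I_n.+1) (x : C n) :
  face r j (alg_refl j x) = x.
Proof.
rewrite -cmap_face -[RHS]alpha_unit; models; exact: face_refl_eq.
Qed.

Lemma alg_conn_conn g n (i j : 'I_n) (x : C n) :
  i <= j -> alg_conn g (wd i) (alg_conn g j x) = alg_conn g (up j) (alg_conn g i x).
Proof. move=> H; rewrite !alpha_conn; models; exact: conn_conn. Qed.

Lemma alg_conn_refl_lt g n (i : 'I_n) (j : 'I_n.+1) (x : C n) :
  i < j -> alg_conn g (wd i) (alg_refl j x) = alg_refl (up j) (alg_conn g i x).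
Proof. move=> H; rewrite alpha_conn alpha_refl; models; exact: conn_refl_lt. Qed.

Lemma alg_conn_refl_gt g n (i : 'I_n) (j : 'I_n.+1) (x : C n) :
  j <= i -> alg_conn g (up i) (alg_refl j x) = alg_refl (wd j) (alg_conn g i x).
Proof. move=> H; rewrite alpha_conn alpha_refl; models; exact: conn_refl_gt. Qed.

Lemma alg_conn_refl_eq g n (j : 'I_n.+1) (x : C n) :
  alg_conn g j (alg_refl j x) = alg_refl (wd j) (alg_refl j x).
Proof. rewrite alpha_conn alpha_refl; models; exact: conn_refl_eq. Qed.

Lemma alg_face_conn_lt r g n (i : 'I_n.+1) (j : 'I_n) (x : C n.+1) :
  i <= j -> face r (wd i) (alg_conn g (up j) x) = alg_conn g j (face r i x).
Proof. move=> H; rewrite -cmap_face; models; exact: face_conn_lt. Qed.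

Lemma alg_face_conn_gt r g n (i : 'I_n.+1) (j : 'I_n) (x : C n.+1) :
  j < i -> face r (up i) (alg_conn g (wd j) x) = alg_conn g j (face r i x).
Proof. move=> H; rewrite -cmap_face; models; exact: face_conn_gt. Qed.

Lemma alg_src_conn_minus n (j : 'I_n.+1) (x : C n.+1) :
  face Src (wd j) (alg_conn Minus j x) = x /\
  face Src (up j) (alg_conn Minus j x) = x.
Proof.
by split; rewrite -cmap_face -[RHS]alpha_unit; models;
   have [] := src_conn_minus j (cmap f x).
Qed.

Lemma alg_tgt_conn_plus n (j : 'I_n.+1) (x : C n.+1) :
  face Tgt (wd j) (alg_conn Plus j x) = x /\
  face Tgt (up j) (alg_conn Plus j x) = x.
Proof.
by split; rewrite -cmap_face -[RHS]alpha_unit; models;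
   have [] := tgt_conn_plus j (cmap f x).
Qed.

Lemma alg_src_conn_plus n (j : 'I_n.+1) (x : C n.+1) :
  face Src (wd j) (alg_conn Plus j x) = alg_refl j (face Src j x) /\
  face Src (up j) (alg_conn Plus j x) = alg_refl j (face Src j x).
Proof.
by split; rewrite -cmap_face; models; have [] := src_conn_plus j (cmap f x).
Qed.

Lemma alg_tgt_conn_minus n (j : 'I_n.+1) (x : C n.+1) :
  face Tgt (wd j) (alg_conn Minus j x) = alg_refl j (face Tgt j x) /\
  face Tgt (up j) (alg_conn Minus j x) = alg_refl j (face Tgt j x).
Proof.
by split; rewrite -cmap_face; models; have [] := tgt_conn_minus j (cmap f x).
Qed.

Definition alg_rcs : reflexive_cubical_set :=
  ReflexiveCubicalSet alg_refl_refl alg_face_refl_lt alg_face_refl_gt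
    alg_face_refl_eq alg_conn_conn alg_conn_refl_lt alg_conn_refl_gt
    alg_conn_refl_eq alg_face_conn_lt alg_face_conn_gt alg_src_conn_minus
    alg_tgt_conn_plus alg_src_conn_plus alg_tgt_conn_minus.

Lemma alg_src_comp n (j : 'I_n.+1) (a b : C n.+1)
    (h : face Tgt j a = face Src j b) :
  face Src j (alg_comp j a b) = face Src j a.
Proof.
rewrite -cmap_face -[RHS]alpha_unit; models; rewrite (model_comp f h).
exact: src_ccomp.
Qed.

Lemma alg_tgt_comp n (j : 'I_n.+1) (a b : C n.+1)
    (h : face Tgt j a = face Src j b) :
  face Tgt j (alg_comp j a b) = face Tgt j b.
Proof.
rewrite -cmap_face -[RHS]alpha_unit; models; rewrite (model_comp f h).
exact: tgt_ccomp.
Qed.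

Lemma alg_face_comp_lt r n (i j : 'I_n.+1) (a b : C n.+2)
    (h : face Tgt (up j) a = face Src (up j) b) : i <= j ->
  exists h' : face Tgt j (face r (wd i) a) = face Src j (face r (wd i) b),
    face r (wd i) (alg_comp (up j) a b)
    = alg_comp j (face r (wd i) a) (face r (wd i) b).
Proof.
move=> le_ij.
have [|h' E] := @alpha_comp_eq _ j (u (face r (wd i) a)) (u (face r (wd i) b))
  (face r (wd i) (wcomp (up j) (u a) (u b))).
  move=> Y f; rewrite ?(wext_unit, cmap_face) (model_comp f h).
  by have [h' E] := face_ccomp_lt _ r _ i j _ _ (model_composable f h) le_ij; exists h'.
move: h' E; rewrite !alpha_unit => h' ->; exists h'.
by rewrite cmap_face.
Qed.

Lemma alg_face_comp_gt r n (i j : 'I_n.+1) (a b : C n.+2)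
    (h : face Tgt (wd j) a = face Src (wd j) b) : j <= i ->
  exists h' : face Tgt j (face r (up i) a) = face Src j (face r (up i) b),
    face r (up i) (alg_comp (wd j) a b)
    = alg_comp j (face r (up i) a) (face r (up i) b).
Proof.
move=> le_ij.
have [|h' E] := @alpha_comp_eq _ j (u (face r (up i) a)) (u (face r (up i) b))
  (face r (up i) (wcomp (wd j) (u a) (u b))).
  move=> Y f; rewrite ?(wext_unit, cmap_face) (model_comp f h).
  by have [h' E] := face_ccomp_gt _ r _ i j _ _ (model_composable f h) le_ij; exists h'.
move: h' E; rewrite !alpha_unit => h' ->; exists h'.
by rewrite cmap_face.
Qed.

Definition alg_magma : cubical_magma :=
  @CubicalMagma alg_rcs (fun n j a b _ => alg_comp j a b) alg_src_comp
    alg_tgt_comp alg_face_comp_lt alg_face_comp_gt.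

Lemma word_tgt_comp n (j : 'I_n.+1) (v w : words C n.+1) :
  face Tgt j v = face Src j w -> face Tgt j (wcomp j v w) = face Tgt j w.
Proof.
move=> h; apply: wext_inj => Y f; rewrite !cmap_face.
by have [h' ->] := wext_comp_ex f h; rewrite tgt_ccomp.
Qed.

Lemma word_src_comp n (j : 'I_n.+1) (v w : words C n.+1) :
  face Tgt j v = face Src j w -> face Src j (wcomp j v w) = face Src j v.
Proof.
move=> h; apply: wext_inj => Y f; rewrite !cmap_face.
by have [h' ->] := wext_comp_ex f h; rewrite src_ccomp.
Qed.

Lemma alg_compA n (j : 'I_n.+1) (a b c : alg_magma n.+1) 
    (hab : face Tgt j a = face Src j b) (hbc : face Tgt j b = face Src j c) :
  exists h1 h2,
    ccomp j (ccomp j a b hab) c h1 = ccomp j a (ccomp j b c hbc) h2.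
Proof.
have h1 : face Tgt j (wcomp j (u a) (u b)) = face Src j (u c).
  by rewrite (word_tgt_comp (unit_composable hab)); exact: unit_composable.
have h2 : face Tgt j (u a) = face Src j (wcomp j (u b) (u c)).
  by rewrite (word_src_comp (unit_composable hbc)); exact: unit_composable.
exists (etrans (tgt_ccomp _ _ _ _ _ hab) hbc).
exists (etrans hab (esym (src_ccomp _ _ _ _ _ hbc))) => /=.
(* Only the outer arguments are exposed as values of alpha; the inner
   composites already are. *)
rewrite -{1}[c]alpha_unit -{2}[a]alpha_unit !alpha_comp //.
apply: alpha_eq => Y f.
have [h1' ->] := wext_comp_ex f h1; have [h2' ->] := wext_comp_ex f h2.
have [k1 [k2 E]] := ccompA _ _ j _ _ _ (model_composable f hab) (model_composable f hbc).
by rewrite (ccomp_congr h1' k1) ?(ccomp_congr h2' k2) ?wext_unit ?model_comp.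
Qed.

Lemma alg_comp1l n (j : 'I_n.+1) (a : alg_magma n.+1) :
  exists h, ccomp j (refl j (face Src j a)) a h = a.
Proof.
have [|h E] := @alpha_comp_eq _ j (wrefl j (u (face Src j a))) (u a) (u a).
  by move=> Y f; rewrite wext_refl !wext_unit cmap_face; apply: ccomp1l.
by move: h E; rewrite !alpha_unit => h E; exists h.
Qed.

Lemma alg_comp1r n (j : 'I_n.+1) (a : alg_magma n.+1) :
  exists h, ccomp j a (refl j (face Tgt j a)) h = a.
Proof.
have [|h E] := @alpha_comp_eq _ j (u a) (wrefl j (u (face Tgt j a))) (u a).
  by move=> Y f; rewrite wext_refl !wext_unit cmap_face; apply: ccomp1r.
by move: h E; rewrite !alpha_unit => h E; exists h.
Qed.

(** The same transfer for the two by two composites of the interchange and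
    transport laws. *)
Lemma alpha_comp_square n (i j : 'I_n.+1) (p q r s x : words C n.+1) :
  (forall (Y : strict_groupoid) (f : cubical_map C Y), exists h1 h2 h3,
     ccomp i (ccomp j (cmap (wext f) p) (cmap (wext f) q) h1)
             (ccomp j (cmap (wext f) r) (cmap (wext f) s) h2) h3
     = cmap (wext f) x) ->
  exists h1 h2 h3,
    ccomp i (ccomp j (cmap alpha p : alg_magma n.+1) (cmap alpha q) h1)
            (ccomp j (cmap alpha r : alg_magma n.+1) (cmap alpha s) h2) h3
    = cmap alpha x.
Proof.
move=> E.
have hpq : face Tgt j p = face Src j q.
  by apply: wext_inj => Y f; have [h _] := E Y f; rewrite !cmap_face.
have hrs : face Tgt j r = face Src j s.
  by apply: wext_inj => Y f; have [_ [h _]] := E Y f; rewrite !cmap_face.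
have [|h3 E3] := @alpha_comp_eq _ i (wcomp j p q) (wcomp j r s) x.
  move=> Y f; have [h1 [h2 [h3 <-]]] := E Y f.
  rewrite (wext_comp hpq h1) (wext_comp hrs h2); by exists h3.
have h1 : face Tgt j (cmap alpha p) = face Src j (cmap alpha q).
  by rewrite -!cmap_face hpq.
have h2 : face Tgt j (cmap alpha r) = face Src j (cmap alpha s).
  by rewrite -!cmap_face hrs.
have E1 := alpha_comp hpq; have E2 := alpha_comp hrs.
by rewrite -E1 -E2 in h3 E3; exists h1, h2, h3.
Qed.

Lemma alg_interchange n (i j : 'I_n.+1) (a b c d : alg_magma n.+1)
    (hab : face Tgt i a = face Src i b) (hcd : face Tgt i c = face Src i d)
    (h : face Tgt j (ccomp i a b hab) = face Src j (ccomp i c d hcd))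
    (hac : face Tgt j a = face Src j c) (hbd : face Tgt j b = face Src j d)
    (h' : face Tgt i (ccomp j a c hac) = face Src i (ccomp j b d hbd)) :
  i != j ->
  ccomp j (ccomp i a b hab) (ccomp i c d hcd) h
  = ccomp i (ccomp j a c hac) (ccomp j b d hbd) h'.
Proof.
move=> ne_ij; have ne_ji : j != i by rewrite eq_sym.
have hw : face Tgt i (wcomp j (u a) (u c)) = face Src i (wcomp j (u b) (u d)).
  apply: wext_inj => Y f; rewrite !cmap_face (model_comp f hac) (model_comp f hbd).
  by apply: interchange_composable => //; apply: model_composable.
have [|h1 [h2 [h3]]] := @alpha_comp_square _ j i (u a) (u b) (u c) (u d)
  (wcomp i (wcomp j (u a) (u c)) (wcomp j (u b) (u d))).
  move=> Y f; rewrite !wext_unit; have [k ->] := wext_comp_ex f hw.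
  exists (model_composable f hab), (model_composable f hcd).
  exists (interchange_composable (model_composable f hab)
    (model_composable f hcd) ne_ij (model_composable f hac) (model_composable f hbd)).
  move: k; rewrite (model_comp f hac) (model_comp f hbd) => k.
  exact: ccomp_interchange.
by rewrite -(alpha_comp hw) /= !alpha_unit.
Qed.

Lemma alg_transport_plus n (j : 'I_n.+1) (a b : alg_magma n.+1) h :
  exists h1 h2 h3,
    conn Plus j (ccomp j a b h)
    = ccomp (up j)
        (ccomp (wd j) (conn Plus j a) (refl (wd j) a) h1)
        (ccomp (wd j) (refl (up j) a) (conn Plus j b) h2) h3.
Proof.
have [|h1 [h2 [h3 E]]] := @alpha_comp_square _ (up j) (wd j)
  (wconn Plus j (u a)) (wrefl (wd j) (u a)) (wrefl (up j) (u a))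
  (wconn Plus j (u b)) (wconn Plus j (wcomp j (u a) (u b))).
  move=> Y f; rewrite !wext_conn !wext_refl !wext_unit (model_comp f h).
  have [h1 [h2 [h3 E]]] := transport_plus _ _ j _ _ (model_composable f h).
  by exists h1, h2, h3.
by exists h1, h2, h3; rewrite E /= alpha_conn.
Qed.

Lemma alg_transport_minus n (j : 'I_n.+1) (a b : alg_magma n.+1) h :
  exists h1 h2 h3,
    conn Minus j (ccomp j a b h)
    = ccomp (up j)
        (ccomp (wd j) (conn Minus j a) (refl (up j) b) h1)
        (ccomp (wd j) (refl (wd j) b) (conn Minus j b) h2) h3.
Proof.
have [|h1 [h2 [h3 E]]] := @alpha_comp_square _ (up j) (wd j)
  (wconn Minus j (u a)) (wrefl (up j) (u b)) (wrefl (wd j) (u b))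
  (wconn Minus j (u b)) (wconn Minus j (wcomp j (u a) (u b))).
  move=> Y f; rewrite !wext_conn !wext_refl !wext_unit (model_comp f h).
  have [h1 [h2 [h3 E]]] := transport_minus _ _ j _ _ (model_composable f h).
  by exists h1, h2, h3.
by exists h1, h2, h3; rewrite E /= alpha_conn.
Qed.

Lemma alg_refl_comp_le n (i : 'I_n.+2) (j : 'I_n.+1) (a b : alg_magma n.+1) h :
  i <= j -> exists h',
    refl i (ccomp j a b h) = ccomp (up j) (refl i a) (refl i b) h'.
Proof.
move=> le_ij.
have [|h' E] := @alpha_comp_eq _ (up j) (wrefl i (u a)) (wrefl i (u b))
  (wrefl i (wcomp j (u a) (u b))).
  move=> Y f; rewrite !(wext_refl, wext_unit) (model_comp f h).
  by have [h' E] := refl_ccomp_le _ _ i j _ _ (model_composable f h) le_ij; exists h'.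
by exists h'; rewrite /= alpha_refl -E.
Qed.

Lemma alg_refl_comp_gt n (i : 'I_n.+2) (j : 'I_n.+1) (a b : alg_magma n.+1) h :
  j < i -> exists h',
    refl i (ccomp j a b h) = ccomp (wd j) (refl i a) (refl i b) h'.
Proof.
move=> lt_ji.
have [|h' E] := @alpha_comp_eq _ (wd j) (wrefl i (u a)) (wrefl i (u b))
  (wrefl i (wcomp j (u a) (u b))).
  move=> Y f; rewrite !(wext_refl, wext_unit) (model_comp f h).
  by have [h' E] := refl_ccomp_gt _ _ i j _ _ (model_composable f h) lt_ji; exists h'.
by exists h'; rewrite /= alpha_refl -E.
Qed.

Lemma alg_conn_comp_lt g n (i j : 'I_n.+1) (a b : alg_magma n.+1) h :
  i < j -> exists h',
    conn g i (ccomp j a b h) = ccomp (up j) (conn g i a) (conn g i b) h'.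
Proof.
move=> lt_ij.
have [|h' E] := @alpha_comp_eq _ (up j) (wconn g i (u a)) (wconn g i (u b))
  (wconn g i (wcomp j (u a) (u b))).
  move=> Y f; rewrite !(wext_conn, wext_unit) (model_comp f h).
  by have [h' E] := conn_ccomp_lt _ g _ i j _ _ (model_composable f h) lt_ij; exists h'.
by exists h'; rewrite /= alpha_conn -E.
Qed.

Lemma alg_conn_comp_gt g n (i j : 'I_n.+1) (a b : alg_magma n.+1) h :
  j < i -> exists h',
    conn g i (ccomp j a b h) = ccomp (wd j) (conn g i a) (conn g i b) h'.
Proof.
move=> lt_ji.
have [|h' E] := @alpha_comp_eq _ (wd j) (wconn g i (u a)) (wconn g i (u b))
  (wconn g i (wcomp j (u a) (u b))).
  move=> Y f; rewrite !(wext_conn, wext_unit) (model_comp f h).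
  by have [h' E] := conn_ccomp_gt _ g _ i j _ _ (model_composable f h) lt_ji; exists h'.
by exists h'; rewrite /= alpha_conn -E.
Qed.

Lemma alg_conn_same n (i : 'I_n.+1) (x : alg_magma n.+1) : exists h,
  ccomp (wd i) (conn Plus i x) (conn Minus i x) h = refl (up i) x.
Proof.
have [|h E] := @alpha_comp_eq _ (wd i) (wconn Plus i (u x)) (wconn Minus i (u x))
  (wrefl (up i) (u x)).
  by move=> Y f; rewrite wext_refl !wext_conn wext_unit; apply: ccomp_conn_same.
by exists h.
Qed.

Lemma alg_conn_next n (i : 'I_n.+1) (x : alg_magma n.+1) : exists h,
  ccomp (up i) (conn Plus i x) (conn Minus i x) h = refl (wd i) x.
Proof.
have [|h E] := @alpha_comp_eq _ (up i) (wconn Plus i (u x)) (wconn Minus i (u x))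
  (wrefl (wd i) (u x)).
  by move=> Y f; rewrite wext_refl !wext_conn wext_unit; apply: ccomp_conn_next.
by exists h.
Qed.

Lemma alg_tgt_rev n (j : 'I_n.+1) (a : alg_magma n.+1) :
  face Tgt j (alg_rev j a : alg_magma n.+1) = face Src j a.
Proof.
rewrite -[a in RHS]alpha_unit -!cmap_face; models; exact: tgt_rev.
Qed.

Lemma alg_src_rev n (j : 'I_n.+1) (a : alg_magma n.+1) :
  face Src j (alg_rev j a : alg_magma n.+1) = face Tgt j a.
Proof.
rewrite -[a in RHS]alpha_unit -!cmap_face; models; exact: src_rev.
Qed.

Lemma alg_comp_revr n (j : 'I_n.+1) (a : alg_magma n.+1) : exists h,
  ccomp j a (alg_rev j a : alg_magma n.+1) h = refl j (face Src j a).
Proof.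
have [|h E] := @alpha_comp_eq _ j (u a) (wrev j (u a)) (wrefl j (u (face Src j a))).
  move=> Y f; rewrite wext_refl wext_rev !wext_unit cmap_face.
  exact: ccomp_revr.
by move: h E; rewrite !alpha_unit => h E; exists h.
Qed.

Lemma alg_comp_revl n (j : 'I_n.+1) (a : alg_magma n.+1) : exists h,
  ccomp j (alg_rev j a : alg_magma n.+1) a h = refl j (face Tgt j a).
Proof.
have [|h E] := @alpha_comp_eq _ j (wrev j (u a)) (u a) (wrefl j (u (face Tgt j a))).
  move=> Y f; rewrite wext_refl wext_rev !wext_unit cmap_face.
  exact: ccomp_revl.
by move: h E; rewrite !alpha_unit => h E; exists h.
Qed.

Definition alg_category : strict_category :=
  @StrictCategory alg_magma alg_compA alg_comp1l alg_comp1r alg_interchange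
    alg_refl_comp_le alg_refl_comp_gt alg_conn_comp_lt alg_conn_comp_gt
    alg_transport_plus alg_transport_minus alg_conn_same alg_conn_next.

Definition alg_groupoid : strict_groupoid :=
  @StrictGroupoid alg_category alg_rev alg_tgt_rev alg_src_rev
    alg_comp_revr alg_comp_revl.

End AlgebraGroupoid.

(** * Free groupoids *)

Lemma cubical_map_eq (X Y : cubical_set) (f g : cubical_map X Y) :
  (forall n (x : X n), cmap f x = cmap g x) -> f = g.
Proof.
move=> E; apply: cubical_map_ext.
apply: functional_extensionality_dep => n; apply: functional_extensionality => x.
exact: E.
Qed.

Lemma cubical_compE (X Y Z : cubical_set) (g : cubical_map Y Z)
    (f : cubical_map X Y) n (x : X n) :
  cmap (cubical_comp g f) x = cmap g (cmap f x).
Proof. by []. Qed.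

Lemma magma_compE (X Y Z : cubical_magma) (g : magma_map Y Z)
    (f : magma_map X Y) n (x : X n) :
  cmap (magma_comp g f) x = cmap g (cmap f x).
Proof. by []. Qed.

Lemma magma_map_eq (X Y : cubical_magma) (f g : magma_map X Y) :
  (forall n (x : X n), cmap f x = cmap g x) -> f = g.
Proof. by move=> E; apply: magma_map_ext; apply: cubical_map_eq. Qed.

Lemma inverse_unique (Y : strict_category) n (j : 'I_n.+1) (a b c : Y n.+1)
    (hab : face Tgt j a = face Src j b) (hca : face Tgt j c = face Src j a) :
  ccomp j a b hab = refl j (face Src j a) ->
  ccomp j c a hca = refl j (face Tgt j a) -> b = c.
Proof.
move=> Eab Eca; have [h1 [h2 E]] := ccompA _ _ j c a b hca hab.
have [k1 E1] := ccomp1l _ _ j b; have [k2 E2] := ccomp1r _ _ j c.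
rewrite -E1 -E2.
have -> : ccomp j (refl j (face Src j b)) b k1 = ccomp j (ccomp j c a hca) b h1.
  by apply: ccomp_congr; rewrite // Eca hab.
by rewrite E; apply: ccomp_congr; rewrite // Eab hca.
Qed.

(** Functors preserve reversors although this is not required of them. *)
Lemma magma_map_rev (X Y : strict_groupoid) (g : magma_map X Y) n (j : 'I_n.+1)
    (a : X n.+1) : cmap g (reversor j a) = reversor j (cmap g a).
Proof.
have [h E] := ccomp_revr _ _ j a; have [k K] := ccomp_revl _ _ j (cmap g a).
have [h' E'] := magma_map_ccomp _ _ g _ _ _ _ h.
apply: (inverse_unique (hab := h') (hca := k)) K.
by rewrite -E' E magma_map_refl cmap_face.
Qed.

Section Free.
Variable X : cubical_set.

Definition mu : cubical_map (words (words X)) (words X) :=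
  bind (cubical_id (words X)).

Lemma mu_unit n (w : words X n) : cmap mu (cmap (wunit (words X)) w) = w.
Proof. exact: bind_unit. Qed.

(** Associativity of the monad: [mu] is an algebra structure on words. *)
Lemma mu_bind n (w : words (words (words X)) n) :
  cmap mu (cmap (bind (cubical_id (words (words X)))) w)
  = cmap mu (cmap (bind (cubical_comp (wunit (words X)) mu)) w).
Proof.
apply: wext_inj => Y f; rewrite !wext_bind; congr (cmap (wext _) w).
by apply: cubical_map_eq => m x; rewrite !cubical_compE wext_unit wext_bind.
Qed.

Definition free : strict_groupoid := alg_groupoid mu_unit mu_bind.

(** The operations that the algebra [mu] induces on words are the formal ones. *)
Lemma free_refl n (j : 'I_n.+1) (w : free n) : refl j w = wrefl j w.
Proof. rewrite -[w in RHS]mu_unit; exact: bind_refl. Qed.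

Lemma free_conn g n (j : 'I_n) (w : free n) : conn g j w = wconn g j w.
Proof. rewrite -[w in RHS]mu_unit; exact: bind_conn. Qed.

Lemma free_rev n (j : 'I_n.+1) (w : free n.+1) : reversor j w = wrev j w.
Proof. rewrite -[w in RHS]mu_unit; exact: bind_rev. Qed.

Lemma free_comp n (j : 'I_n.+1) (v w : free n.+1)
    (h : face Tgt j v = face Src j w) : ccomp j v w h = wcomp j v w.
Proof.
rewrite -[v in RHS]mu_unit -[w in RHS]mu_unit; apply: bind_comp.
by rewrite -!cmap_face h.
Qed.

Section Extension.
Variables (Y : strict_groupoid) (f : cubical_map X Y).

Lemma free_ext_refl n (j : 'I_n.+1) (w : free n) :
  cmap (wext f) (refl j w) = refl j (cmap (wext f) w).
Proof. by rewrite free_refl wext_refl. Qed.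

Lemma free_ext_conn g n (j : 'I_n) (w : free n) :
  cmap (wext f) (conn g j w) = conn g j (cmap (wext f) w).
Proof. by rewrite free_conn wext_conn. Qed.

Lemma free_ext_comp n (j : 'I_n.+1) (v w : free n.+1)
    (h : face Tgt j v = face Src j w) : exists h',
  cmap (wext f) (ccomp j v w h)
  = ccomp j (cmap (wext f) v) (cmap (wext f) w) h'.
Proof. by rewrite free_comp; apply: wext_comp_ex. Qed.

Definition free_ext : magma_map free Y :=
  @MagmaMap free Y (wext f) free_ext_refl free_ext_conn free_ext_comp.

(** Every word is built from generators by the operations, all of which a functor
    preserves; hence induction on a representing term. *)
Lemma free_ext_uniq (g : magma_map free Y) :
  (forall n (x : X n), cmap g (cmap (wunit X) x) = cmap f x) ->
  forall n (w : free n), cmap g w = cmap (wext f) w.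
Proof.
move=> gf; suff E n (t : term X n) (wt : wf t) : cmap g (class wt : free n) = ev f t.
  move=> n w; have -> : w = class (repr_wf w).
    by apply: wext_inj => Z k; rewrite wext_class.
  by rewrite E wext_class.
elim: t wt => {n} [n x|n r j s IHs|n j s IHs|n s' j s IHs|n j s IHs t IHt|n j s IHs] wt /=.
- rewrite -gf; congr cmap; apply: wext_inj => Z k.
  by rewrite wext_unit wext_class.
- rewrite -(IHs wt) -cmap_face; congr cmap; apply: wext_inj => Z k.
  by rewrite cmap_face !wext_class.
- rewrite -(IHs wt) -magma_map_refl free_refl; congr cmap; apply: wext_inj => Z k.
  by rewrite wext_refl !wext_class.
- rewrite -(IHs wt) -magma_map_conn free_conn; congr cmap; apply: wext_inj => Z k.
  by rewrite wext_conn !wext_class.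
- case: (wt) => ws wu E.
  have h : face Tgt j (class ws : free n.+1) = face Src j (class wu : free n.+1).
    by apply: wext_inj => Z k; rewrite !cmap_face !wext_class.
  have [h' E'] := magma_map_ccomp _ _ g _ _ _ _ h.
  rewrite -(IHs ws) -(IHt wu) (total_compE h') -E' free_comp.
  congr cmap; apply: wext_inj => Z k; have [h'' ->] := wext_comp_ex k h.
  by rewrite -total_compE !wext_class.
- rewrite -(IHs wt) -magma_map_rev free_rev; congr cmap; apply: wext_inj => Z k.
  by rewrite wext_rev !wext_class.
Qed.

End Extension.

Lemma free_hom_eq (Y : strict_groupoid) (g g' : magma_map free Y) :
  (forall n (x : X n), cmap g (cmap (wunit X) x) = cmap g' (cmap (wunit X) x)) ->
  g = g'.
Proof.
move=> E; apply: magma_map_eq => n w.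
by rewrite !(@free_ext_uniq Y (cubical_comp g' (wunit X))).
Qed.

End Free.

Lemma free_extE (X : cubical_set) (Y : strict_groupoid) (f : cubical_map X Y) n
    (x : X n) : cmap (free_ext f) (cmap (wunit X) x) = cmap f x.
Proof. exact: wext_unit. Qed.

(** Extension along maps into a free groupoid is substitution; this relates the
    law of Eilenberg-Moore algebras, stated with the adjunction, to [bind]. *)
Lemma wext_free_bind (X Z : cubical_set) (k : cubical_map X (free Z)) n
    (w : words X n) : cmap (wext k) w = cmap (bind (k : cubical_map X (words Z))) w.
Proof.
apply: wext_inj => Y f; rewrite wext_bind.
apply: (@free_ext_uniq _ _ _ (magma_comp (free_ext f) (free_ext k))) => m x.
by rewrite magma_compE free_extE.
Qed.

(** * The adjunction *)

Definition free_map (X Y : cubical_set) (f : cubical_map X Y) :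
    magma_map (free X) (free Y) :=
  free_ext (cubical_comp (wunit Y) f : cubical_map X (free Y)).

Lemma free_mapE (X Y : cubical_set) (f : cubical_map X Y) n (x : X n) :
  cmap (free_map f) (cmap (wunit X) x) = cmap (wunit Y) (cmap f x).
Proof. exact: free_extE. Qed.

Lemma free_map1 (X : cubical_set) :
  free_map (cubical_id X) = magma_id (free X).
Proof. by apply: free_hom_eq => n x; rewrite free_mapE. Qed.

Lemma free_map_comp (X Y Z : cubical_set) (g : cubical_map Y Z)
    (f : cubical_map X Y) :
  free_map (cubical_comp g f) = magma_comp (free_map g) (free_map f).
Proof. by apply: free_hom_eq => n x; rewrite magma_compE !free_mapE. Qed.

Definition free_functor : functor CSets CGrp :=
  @Functor CSets CGrp free free_map free_map1 free_map_comp.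

Lemma wunit_nat (X Y : cubical_set) (f : cubical_map X Y) :
  cubical_comp (wunit Y) f = cubical_comp (free_map f) (wunit X).
Proof. by apply: cubical_map_eq => n x; rewrite cubical_compE -free_mapE. Qed.

Definition counit (Y : strict_groupoid) : magma_map (free Y) Y :=
  free_ext (cubical_id Y).

Lemma counitE (Y : strict_groupoid) n (y : Y n) :
  cmap (counit Y) (cmap (wunit Y) y) = y.
Proof. exact: free_extE. Qed.

Lemma counit_nat (X Y : strict_groupoid) (f : magma_map X Y) :
  magma_comp (counit Y) (free_map f) = magma_comp f (counit X).
Proof.
by apply: free_hom_eq => n x; rewrite !magma_compE free_mapE !counitE.
Qed.

Lemma free_triangleF (X : cubical_set) :
  magma_comp (counit (free X)) (free_map (wunit X)) = magma_id (free X).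
Proof. by apply: free_hom_eq => n x; rewrite magma_compE free_mapE counitE. Qed.

Lemma free_triangleU (Y : strict_groupoid) :
  cubical_comp (counit Y) (wunit Y) = cubical_id Y.
Proof. by apply: cubical_map_eq => n y; rewrite cubical_compE counitE. Qed.

Definition free_adj : adjunction free_functor forget :=
  @Adjunction CGrp CSets free_functor forget
    (@NatTrans _ _ (functor_id CSets) (functor_comp forget free_functor)
       (fun X : CSets => wunit X) wunit_nat)
    (@NatTrans _ _ (functor_comp free_functor forget) (functor_id CGrp)
       (fun Y : CGrp => counit Y) counit_nat)
    free_triangleF free_triangleU.

(** * The comparison functor is an equivalence *)

Section AlgebraToGroupoid.
Variable A : algebra (adj_monad free_adj).

Definition structure : cubical_map (words (acar A)) (acar A) := aact A.

Lemma structure_unit n (c : (acar A : cubical_set) n) :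
  cmap structure (cmap (wunit (acar A)) c) = c.
Proof.
exact: (congr1 (fun k : cubical_map (acar A) (acar A) => cmap k c) (aact_ret A)).
Qed.

Lemma structure_bind n (w : words (words (acar A)) n) :
  cmap structure (cmap (bind (cubical_id (words (acar A)))) w)
  = cmap structure (cmap (bind (cubical_comp (wunit (acar A)) structure)) w).
Proof.
have E := congr1 (fun k : cubical_map (words (words (acar A))) (acar A) => cmap k w)
  (aact_join A).
by rewrite -!wext_free_bind; symmetry; exact: E.
Qed.

Definition algebra_groupoid : strict_groupoid :=
  alg_groupoid structure_unit structure_bind.

Let str : cubical_map (free (acar A)) algebra_groupoid := structure.

Lemma structure_hom_refl n (j : 'I_n.+1) (w : free (acar A) n) :
  cmap str (refl j w) = refl j (cmap str w).
Proof. by rewrite free_refl; symmetry; apply: (alpha_refl structure_bind). Qed.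

Lemma structure_hom_conn g n (j : 'I_n) (w : free (acar A) n) :
  cmap str (conn g j w) = conn g j (cmap str w).
Proof. by rewrite free_conn; symmetry; apply: (alpha_conn structure_bind). Qed.

Lemma structure_hom_comp n (j : 'I_n.+1) (v w : free (acar A) n.+1)
    (h : face Tgt j v = face Src j w) : exists h',
  cmap str (ccomp j v w h) = ccomp j (cmap str v) (cmap str w) h'.
Proof.
have h' : face Tgt j (cmap str v) = face Src j (cmap str w).
  by rewrite -!cmap_face h.
exists h'; rewrite free_comp; symmetry.
exact: (alpha_comp structure_bind (j := j) (v := v) (w := w) h).
Qed.

Definition structure_hom : magma_map (free (acar A)) algebra_groupoid :=
  @MagmaMap (free (acar A)) algebra_groupoid str structure_hom_refl structure_hom_conn
    structure_hom_comp.

End AlgebraToGroupoid.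

(** The operations of a quotient Q of P that splits in cubical sets are determined
    by those of P: the section lifts composable cells to composable cells. So a
    cubical map out of Q is a functor as soon as its restriction to P is one. *)
Section Descend.
Variables (P Q R : cubical_magma) (p : magma_map P Q) (s : cubical_map Q P).
Hypothesis ps : forall n (x : Q n), cmap p (cmap s x) = x.
Variables (q : magma_map P R) (k : cubical_map Q R).
Hypothesis kp : forall n (x : P n), cmap k (cmap p x) = cmap q x.

Lemma descend_section n (x : Q n) : cmap q (cmap s x) = cmap k x.
Proof. by rewrite -kp ps. Qed.

Lemma descend_refl n (j : 'I_n.+1) (x : Q n) :
  cmap k (refl j x) = refl j (cmap k x).
Proof. by rewrite -[x in LHS]ps -magma_map_refl kp magma_map_refl descend_section. Qed.

Lemma descend_conn g n (j : 'I_n) (x : Q n) :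
  cmap k (conn g j x) = conn g j (cmap k x).
Proof. by rewrite -[x in LHS]ps -magma_map_conn kp magma_map_conn descend_section. Qed.

Lemma descend_comp n (j : 'I_n.+1) (x y : Q n.+1)
    (h : face Tgt j x = face Src j y) : exists h',
  cmap k (ccomp j x y h) = ccomp j (cmap k x) (cmap k y) h'.
Proof.
have hs : face Tgt j (cmap s x) = face Src j (cmap s y) by rewrite -!cmap_face h.
have [h1 E1] := magma_map_ccomp _ _ p _ _ _ _ hs.
have [h2 E2] := magma_map_ccomp _ _ q _ _ _ _ hs.
have E : ccomp j x y h = cmap p (ccomp j (cmap s x) (cmap s y) hs).
  by rewrite E1; apply: ccomp_congr; rewrite ps.
move: h2 E2; rewrite -(kp (ccomp j _ _ hs)) -E !descend_section => h2 ->.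
by exists h2.
Qed.

Definition descend : magma_map Q R :=
  @MagmaMap Q R k descend_refl descend_conn descend_comp.

End Descend.

Section GroupoidMap.
Variables (A B : algebra (adj_monad free_adj)) (h : algebra_hom A B).
Let k : cubical_map (algebra_groupoid A) (algebra_groupoid B) := ahom h.

Lemma ahom_structure n (w : free (acar A) n) :
  cmap k (cmap (structure_hom A) w)
  = cmap (magma_comp (structure_hom B) (free_map k)) w.
Proof.
exact: (congr1 (fun l : cubical_map (words (acar A)) (acar B) => cmap l w) (ahomP h)).
Qed.

Definition groupoid_map : magma_map (algebra_groupoid A) (algebra_groupoid B) :=
  descend (p := structure_hom A) (s := wunit (acar A)) (@structure_unit A)
    ahom_structure.

End GroupoidMap.

Lemma groupoid_map1 (A : algebra (adj_monad free_adj)) :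
  groupoid_map (algebra_id A) = magma_id (algebra_groupoid A).
Proof. exact: magma_map_eq. Qed.

Lemma groupoid_mapM (A B D : algebra (adj_monad free_adj))
    (g : algebra_hom B D) (f : algebra_hom A B) :
  groupoid_map (algebra_comp g f) = magma_comp (groupoid_map g) (groupoid_map f).
Proof. exact: magma_map_eq. Qed.

Definition groupoid_functor : functor (eilenberg_moore (adj_monad free_adj)) CGrp :=
  @Functor (eilenberg_moore (adj_monad free_adj)) CGrp algebra_groupoid groupoid_map
    groupoid_map1 groupoid_mapM.

(** A groupoid Y and the groupoid of the algebra it induces are both split
    quotients of the free groupoid on Y by the same cubical map, so the identity
    on cells is a functor in both directions. *)
Definition from_comparison (Y : strict_groupoid) :
    magma_map (algebra_groupoid (comparison_ob free_adj Y)) Y :=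
  descend (p := structure_hom (comparison_ob free_adj Y)) (s := wunit Y)
    (q := counit Y) (k := cubical_id Y)
    (@structure_unit (comparison_ob free_adj Y)) (fun n x => erefl).

Definition to_comparison (Y : strict_groupoid) :
    magma_map Y (algebra_groupoid (comparison_ob free_adj Y)) :=
  descend (p := counit Y) (s := wunit Y)
    (q := structure_hom (comparison_ob free_adj Y)) (k := cubical_id Y)
    (@counitE Y) (fun n x => erefl).

Lemma algebra_groupoid_comparison :
  naturally_isomorphic
    (functor_comp groupoid_functor (comparison_functor free_adj))
    (functor_id CGrp).
Proof.
have nat_from (X Y : strict_groupoid) (f : magma_map X Y) :
    magma_comp (from_comparison Y) (groupoid_map (comparison_map free_adj f))
    = magma_comp f (from_comparison X).
  exact: magma_map_eq.
exists (@NatTrans _ _ (functor_comp groupoid_functor (comparison_functor free_adj))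
  (functor_id CGrp) from_comparison nat_from) => Y.
by exists (to_comparison Y); split; apply: magma_map_eq.
Qed.

(** Both sides are functors on the free groupoid that restrict to the identity
    on generators. *)
Lemma structure_counit (A : algebra (adj_monad free_adj)) n
    (w : free (acar A) n) :
  cmap (counit (algebra_groupoid A)) w = cmap (structure A) w.
Proof.
suff -> : counit (algebra_groupoid A) = structure_hom A by [].
by apply: free_hom_eq => m c; rewrite counitE; symmetry; apply: structure_unit.
Qed.

Lemma comparison_algebra_groupoid :
  naturally_isomorphic
    (functor_comp (comparison_functor free_adj) groupoid_functor)
    (functor_id (eilenberg_moore (adj_monad free_adj))).
Proof.
have fwd (A : algebra (adj_monad free_adj)) :
    idc (acar A) \oc aact (comparison_ob free_adj (algebra_groupoid A))
    = aact A \oc fmap (adj_monad free_adj) (idc (acar A)).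
  by rewrite fmap1; apply: cubical_map_eq => n w; apply: structure_counit.
have bwd (A : algebra (adj_monad free_adj)) :
    idc (acar A) \oc aact A
    = aact (comparison_ob free_adj (algebra_groupoid A))
      \oc fmap (adj_monad free_adj) (idc (acar A)).
  by rewrite fmap1; apply: cubical_map_eq => n w; symmetry; apply: structure_counit.
pose to (A : algebra (adj_monad free_adj)) :
  algebra_hom (comparison_ob free_adj (algebra_groupoid A)) A := AlgebraHom (fwd A).
have nat_to (A B : algebra (adj_monad free_adj)) (h : algebra_hom A B) :
    algebra_comp (to B) (comparison_map free_adj (groupoid_map h))
    = algebra_comp h (to A).
  by apply: algebra_hom_ext; apply: cubical_map_eq.
exists (@NatTrans _ _ (functor_comp (comparison_functor free_adj) groupoid_functor)
  (functor_id (eilenberg_moore (adj_monad free_adj))) to nat_to) => A.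
exists (@AlgebraHom _ _ A (comparison_ob free_adj (algebra_groupoid A)) _ (bwd A)).
by split; apply: algebra_hom_ext; apply: cubical_map_eq.
Qed.

Theorem proposition4 : is_right_adjoint forget /\ is_monadic forget.
Proof.
split; first by exists free_functor; constructor; exact: free_adj.
exists free_functor, free_adj, groupoid_functor; split.
  exact: algebra_groupoid_comparison.
exact: comparison_algebra_groupoid.
Qed.
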